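(* Consider two linearly edge-reinforced walkers $X^{(1)},X^{(2)}$ on the 3-node segment with vertices $-1,0,1$ where the walker to move is selected uniformly at random at every step (as defined in the context), with $N_n=\frac{w(n,-1)}{w(n,-1)+w(n,0)}$, $\tau_0=0$, $\tau_n=\inf\{m>\tau_{n-1}:X^{(1)}_m=X^{(2)}_m=0\}$ for $n\ge1$, and $M^{\mathrm{rd}}_n:=N_{\tau_n}$ for $n\ge0$. Then the following hold. (i) $(M^{\mathrm{rd}}_n)_{n\ge0}$ is a bounded martingale (with respect to its natural filtration); define $M^{\mathrm{rd}}_\infty:=\lim_{n\to\infty}M^{\mathrm{rd}}_n$ (almost sure limit). (ii) For every $n\ge 0$, $\mathbb P[\tau_{n+1}-\tau_n=2l]=2^{-l}$ for all integers $l\ge1$, and $\mathbb E[\tau_{n+1}-\tau_n]=4$. (iii) $\lim_{n\to\infty}N_n=M^{\mathrm{rd}}_\infty$ almost surely.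
   Context: **Model (two walkers, random walker selection).** The graph is the segment with vertex set $\{-1,0,1\}$ and edges $\{-1,0\}$ (the left edge, denoted by $-1$) and $\{0,1\}$ (the right edge, denoted by $0$). There are two walkers $X^{(1)},X^{(2)}$ with $X^{(1)}_0=X^{(2)}_0=0$. For $\ell\in\{-1,0\}$ put $c(0,\ell)=0$ and, for $n\ge1$, $c(n,\ell)=\sum_{k=1}^2\sum_{i=1}^n \mathbf 1\{\{X^{(k)}_{i-1},X^{(k)}_i\}=\{\ell,\ell+1\}\}$, the total number of crossings of edge $\{\ell,\ell+1\}$ by both walkers up to time $n$. The weight of this edge at time $n$ is $w(n,\ell)=1+c(n,\ell)$. At every time step exactly one of the two walkers is chosen uniformly at random (probability $\frac12$ each, independently of all other steps and of the past) and moves; the other walker stays put. Given the history up to time $n$ and the choice of walker, if the chosen walker is at $0$, it jumps to $1$ with probability $\frac{w(n,0)}{w(n,-1)+w(n,0)}$ and to $-1$ with probability $\frac{w(n,-1)}{w(n,-1)+w(n,0)}$; if it is at $-1$ or $1$, it jumps to $0$ with probability one. *)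

(* Defs.v *)
From HB Require Import structures.
From mathcomp Require Import all_boot all_order all_algebra.
From mathcomp Require Import all_classical all_reals all_analysis.
Set Implicit Arguments.
Unset Strict Implicit.
Unset Printing Implicit Defensive.
Import Order.TTheory GRing.Theory Num.Theory.
Import numFieldNormedType.Exports.
Local Open Scope classical_set_scope.
Local Open Scope ring_scope.

(** * Filtrations and martingales *)

Definition sigma_measurable {d} {T : measurableType d} {R : realType}
    (G : set_system T) (Y : T -> R) : Prop :=
  forall B : set R, measurable B -> G (Y @^-1` B).

(* [Z] is a version of the conditional expectation of [Y] given the
   sub-sigma-algebra [G]. *)
Definition is_cond_expectation {d} {T : measurableType d} {R : realType}
    (P : probability T R) (G : set_system T) (Y Z : T -> R) : Prop :=
  [/\ P.-integrable setT (EFin \o Y),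
      P.-integrable setT (EFin \o Z),
      sigma_measurable G Z &
      forall A, G A -> (\int[P]_(w in A) (Z w)%:E = \int[P]_(w in A) (Y w)%:E)%E].

Definition filtration {d} {T : measurableType d}
    (F : nat -> set_system T) : Prop :=
  [/\ forall n, sigma_algebra setT (F n),
      forall n, F n `<=` measurable &
      forall n m, (n <= m)%N -> F n `<=` F m].

Definition natural_filtration {d} {T : measurableType d} {R : realType}
    (M : nat -> T -> R) (n : nat) : set_system T :=
  <<s \bigcup_(i in [set i | (i <= n)%N])
        preimage_set_system setT (M i) measurable >>.

Definition martingale {d} {T : measurableType d} {R : realType}
    (P : probability T R) (F : nat -> set_system T) (M : nat -> T -> R) : Prop :=
  [/\ filtration F,
      forall n, P.-integrable setT (EFin \o M n),
      forall n, sigma_measurable (F n) (M n) &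
      forall n, is_cond_expectation P (F n) (M n.+1) (M n)].

(** * Two reinforced walkers on the segment with vertices -1, 0, 1 *)

(* A trajectory [x] of the pair of walkers: [x k n] is the position of walker
   [k : 'I_2] at time [n].  The edge {l, l + 1} is denoted by its left
   endpoint [l] (so l = -1 or l = 0). *)

Definition crosses (a b l : int) : bool :=
  ((a == l) && (b == l + 1)) || ((a == l + 1) && (b == l)).

Definition crossings (x : 'I_2 -> nat -> int) (n : nat) (l : int) : nat :=
  (\sum_(k < 2) \sum_(1 <= i < n.+1) crosses (x k i.-1) (x k i) l)%N.

Definition weight (x : 'I_2 -> nat -> int) (n : nat) (l : int) : nat :=
  (1 + crossings x n l)%N.

Definition left_ratio {R : realType} (x : 'I_2 -> nat -> int) (n : nat) : R :=
  (weight x n (-1))%:R / (weight x n (-1) + weight x n 0)%:R.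

Definition right_ratio {R : realType} (x : 'I_2 -> nat -> int) (n : nat) : R :=
  (weight x n 0)%:R / (weight x n (-1) + weight x n 0)%:R.

(* Probability that walker [k], if chosen to move after the trajectory [x] up
   to time [n], jumps to [y]. *)
Definition jump_prob {R : realType} (x : 'I_2 -> nat -> int) (n : nat)
    (k : 'I_2) (y : int) : R :=
  if x k n == 0 then
    if y == 1 then right_ratio x n
    else if y == -1 then left_ratio x n
    else 0
  else (y == 0)%:R.

(* [sel n] is the walker chosen to make the step from time [n] to time [n + 1];
   the history up to time [n] records the positions up to time [n] and the
   choices made so far. *)
Definition history {T : Type} (X : 'I_2 -> nat -> T -> int) (sel : nat -> T -> 'I_2)
    (n : nat) (x : 'I_2 -> nat -> int) (s : nat -> 'I_2) : set T :=
  [set w | (forall k i, (i <= n)%N -> X k i w = x k i) /\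
           (forall i, (i < n)%N -> sel i w = s i)].

(* The process is discrete, so independence and conditional laws given the
   history are expressed on its atoms, in product form
   P (A /\ H) = P (A | H) P (H), which is void when P (H) = 0. *)
Record two_walkers {d} {T : measurableType d} {R : realType}
    (P : probability T R)
    (X : 'I_2 -> nat -> T -> int) (sel : nat -> T -> 'I_2) : Prop := {
  walker_measurable : forall k n y, measurable [set w | X k n w = y];
  choice_measurable : forall n k, measurable [set w | sel n w = k];
  walker_vertex : forall k n w, X k n w \in [:: -1; 0; 1 : int];
  walker_start : forall k w, X k 0%N w = 0;
  walker_stay : forall k n w, k != sel n w -> X k n.+1 w = X k n w;
  choice_uniform : forall n x s k,
    (P (history X sel n x s `&` [set w | sel n w = k])
       = (2^-1)%:E * P (history X sel n x s))%E;
  walker_jump : forall n x s k y,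
    (P (history X sel n x s `&` [set w | sel n w = k] `&` [set w | X k n.+1 w = y])
       = (jump_prob x n k y)%:E *
         P (history X sel n x s `&` [set w | sel n w = k]))%E }.

Definition Nproc {T : Type} {R : realType} (X : 'I_2 -> nat -> T -> int)
    (n : nat) (w : T) : R :=
  left_ratio (fun k i => X k i w) n.

(* The infimum is taken in the extended reals: +oo if there is no further
   common visit to 0. *)
Fixpoint tau {T : Type} {R : realType} (X : 'I_2 -> nat -> T -> int)
    (n : nat) (w : T) : \bar R :=
  match n with
  | 0%N => 0%E
  | n'.+1 => ereal_inf [set (m%:R : R)%:E | m in
      [set m : nat | (@tau T R X n' w < (m%:R : R)%:E)%E /\
                     forall k, X k m w = 0]]
  end.

(* N at time tau_n; where tau_n = +oo the time 0 is used instead. *)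
Definition Mrd {T : Type} {R : realType} (X : 'I_2 -> nat -> T -> int)
    (n : nat) (w : T) : R :=
  Nproc X (Num.truncn (fine (tau X n w : \bar R))) w.

Definition Mrd_lim {T : Type} {R : realType} (X : 'I_2 -> nat -> T -> int)
    (w : T) : R :=
  limn (fun n => Mrd X n w : R).

(* Main.v *)
Require Import Defs.
From HB Require Import structures.
From mathcomp Require Import all_boot all_order all_algebra.
From mathcomp Require Import all_classical all_reals all_analysis.
From mathcomp Require Import measurable_realfun ring lra zify.
Import Order.TTheory GRing.Theory Num.Theory.
Import numFieldNormedType.Exports.
Local Open Scope classical_set_scope.
Local Open Scope ring_scope.

(** The pair (weights, positions) is a Markov chain. For an excursion of the pair
away from (0, 0), look one step before a possible return, when one walker is at
0 and the other at x: if u is the left weight, s the total weight and e = [x = -1],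
the expectation of the left ratio at a return in 2l + 1 further steps is
2^-(l+1) (al * u + be * e) with al * s + be = 1, by induction on l. Averaging over
the first jump from (0, 0) gives 2^-l times the initial ratio for a return after
2l steps, hence both the martingale property and the independence of the return
time from the past.

For the convergence, count in advance the return crossing that each walker away
from 0 still has to make. The ratio so modified has one-step drift O(1/n^2) and
increments O(1/n), so E (N_m - N_n)^2 = O((m - n)/n^2). Along the cubes this
makes the increments almost surely absolutely summable, and between consecutive
cubes k^3 and (k+1)^3 the ratio moves by O(1/k). So N_n converges almost surely
in deterministic time, and N_(tau_n) has the same limit because n <= tau_n < oo. *)

(** * Series and convergence along cubes *)

Lemma eseries_EFin {R : realType} (f : nat -> R) (l : R) :
  series f @ \oo --> l -> (\sum_(i <oo) (f i)%:E = l%:E)%E.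
Proof.
move=> fl; apply/cvg_lim => //; apply: cvg_EFin.
  by apply: nearW => n; rewrite sumEFin.
by rewrite (_ : _ \o _ = series f)//; apply/funext => n /=; rewrite sumEFin.
Qed.

Lemma half_series {R : realType} : (\sum_(l <oo) (2^-1 ^+ l.+1 : R)%:E = 1)%E.
Proof.
apply: eseries_EFin; have /= := @cvg_geometric_series R 2^-1 2^-1.
rewrite (_ : 2^-1 / (1 - 2^-1) = 1 :> R); last by field.
move=> h; rewrite (_ : (fun l => 2^-1 ^+ l.+1) = geometric 2^-1 2^-1).
  by apply: h; rewrite gtr0_norm ?invf_lt1 ?ltr1n.
by apply/funext => l; rewrite exprS.
Qed.

Lemma mean_half_series {R : realType} :
  (\sum_(l <oo) ((l.+1.*2)%:R * 2^-1 ^+ l.+1 : R)%:E = 4%:E)%E.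
Proof.
apply: eseries_EFin.
(* The closed form leaves the remainder (2n + 4) 2^-n, which has to tend to 0. *)
have E n : series (fun l => (l.+1.*2)%:R * 2^-1 ^+ l.+1 : R) n =
    4 - (n.*2 + 4)%:R * 2^-1 ^+ n.
  elim: n => [|n IH]; first by rewrite /series /= big_geq// expr0 mulr1 add0n subrr.
  rewrite seriesS IH -!muln2 !natrM !natrD !natrM -[n.+1]addn1 !natrD exprD expr1.
  by field.
rewrite (_ : series _ = fun n => 4 - (n.*2 + 4)%:R * 2^-1 ^+ n); last exact/funext.
rewrite -[X in _ --> X]subr0; apply: cvgB; first exact: cvg_cst.
(* Since 2n + 4 <= 4 (3/2)^n by induction, the remainder is at most 4 (3/4)^n. *)
apply: (@squeeze_cvgr _ _ _ _ (fun=> 0) (geometric 4 (3 / 4))).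
- apply: nearW => n; rewrite mulr_ge0 ?exprn_ge0//=.
  have -> : (3 / 4 : R) = (3 / 2) * 2^-1 by field.
  rewrite exprMn mulrA ler_wpM2r ?exprn_ge0//.
  elim: n => [|n IH]; first by rewrite expr0 mulr1.
  rewrite -!muln2 !natrD !natrM in IH *; have n0 := ler0n R n.
  rewrite exprS -[n.+1]addn1 natrD; nra.
- exact: cvg_cst.
- by apply: cvg_geometric; rewrite gtr0_norm; lra.
Qed.

(** From the second one on, the terms are dominated by the telescoping 1/k - 1/(k + 1). The
    induction therefore carries the sharper bound 2 - 1/(m + 1). *)
Lemma series_inv_square_bounded {R : realType} n :
  series (fun k => (k.+1%:R ^+ 2)^-1 : R) n <= 2.
Proof.
suff H m : series (fun k => (k.+1%:R ^+ 2)^-1 : R) m.+1 <= 2 - m.+1%:R^-1.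
  case: n => [|n]; first by rewrite /series /= big_geq.
  by apply: le_trans (H n) _; rewrite gerBl.
elim: m => [|m IH].
  by rewrite seriesS /series /= big_geq// addr0 expr1n invr1; lra.
rewrite seriesS; apply: le_trans (lerD (lexx _) IH) _.
have m0 : 0 < m.+1%:R :> R by rewrite ltr0n.
rewrite -[m.+2%:R]natr1; move: (m.+1%:R) m0 => a a0.
have -> : 2 - (a + 1)^-1 = 2 - a^-1 + (a * (a + 1))^-1.
  by field; rewrite !gt_eqF//; lra.
rewrite addrC lerD2l lef_pV2 ?posrE//; nra.
Qed.

(** With p = (k + 1)|z_k| and q = 1/(k + 1), one has |z_k| = p q <= p^2 + q^2, and both squares are
    summable. So the increments are absolutely summable. *)
Lemma weighted_increments_cvg {R : realType} (y : R^nat) :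
  (\sum_(k <oo) ((k.+1%:R ^+ 2) * (y k.+1 - y k) ^+ 2)%:E < +oo)%E -> cvgn y.
Proof.
move=> fin.
pose z k := y k.+1 - y k.
have Z n : series z n = y n - y 0%N by rewrite /series /= telescope_sumr.
have [M hM] : exists M, forall n, series (fun k => k.+1%:R ^+ 2 * (z k) ^+ 2) n <= M.
  exists (fine (\sum_(k <oo) ((k.+1%:R ^+ 2) * (y k.+1 - y k) ^+ 2)%:E)) => n.
  rewrite -lee_fin fineK; last first.
    rewrite ge0_fin_numE//; apply: nneseries_ge0 => k _ _.
    by rewrite lee_fin mulr_ge0// sqr_ge0.
  rewrite /series /= -sumEFin; apply: nneseries_lim_ge => k _ _.
  by rewrite lee_fin mulr_ge0// sqr_ge0.
have : cvgn [normed series z].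
  apply: nondecreasing_is_cvgn.
    by apply/nondecreasing_series => k _ _; exact: normr_ge0.
  exists (M + 2) => _ [n _ <-].
  apply: (@le_trans _ _ (series (fun k => k.+1%:R ^+ 2 * (z k) ^+ 2) n +
      series (fun k => (k.+1%:R ^+ 2)^-1) n)).
    rewrite /series /= -big_split; apply: ler_sum => k _ /=.
    have k0 : 0 < k.+1%:R :> R by rewrite ltr0n.
    rewrite -(real_normK (num_real (z k))) -exprVn -exprMn.
    rewrite [leLHS](_ : _ = (k.+1%:R * `|z k|) * k.+1%:R^-1); last first.
      by rewrite mulrC mulKf// gt_eqF.
    have p : 0 <= k.+1%:R * `|z k| by rewrite mulr_ge0.
    have q : 0 <= k.+1%:R^-1 :> R by rewrite invr_ge0 ltW.
    move: p q; move: (k.+1%:R * `|z k|) (k.+1%:R^-1) => p q p0 q0; nra.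
  by apply: lerD; [exact: hM|exact: series_inv_square_bounded].
move=> /normed_cvg h.
rewrite (_ : y = series z + cst (y 0%N)); first exact: is_cvgD h (is_cvg_cst _).
by apply/funext => n; rewrite /GRing.add /= Z subrK.
Qed.

Lemma cubes_cvg {R : realType} (x : R^nat) (l : R) :
  (forall n m, (n <= m)%N -> `|x m - x n| <= (m - n)%:R / (n + 2)%:R) ->
  (fun k => x (k ^ 3)%N) @ \oo --> l -> x @ \oo --> l.
Proof.
move=> hx /cvgrPdist_le hl; apply/cvgrPdist_le => e e0.
have e2 : 0 < e / 2 by rewrite divr_gt0.
have [K1 _ hK1] := hl _ e2.
(* The oscillation after k^3 is at most 12/(k + 1): at most 3 (k + 1)^2 steps of size 1/(k^3 + 2),
   together with (k + 1)^3 <= 4 (k^3 + 2). *)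
have [K2 hK2] : exists K, forall k, (K <= k)%N -> 12 / k.+1%:R <= e / 2.
  exists (Num.truncn (24 / e)) => k Kk.
  have := truncnS_gt (24 / e); rewrite ler_pdivrMr ?ltr0n//.
  have : (Num.truncn (24 / e)).+1%:R <= k.+1%:R :> R by rewrite ler_nat.
  move=> a b; have := lt_le_trans b a; rewrite ltr_pdivrMr//; lra.
exists (maxn K1 K2 ^ 3)%N => // n /= Kn.
(* The integer cube root of [n] is taken as the largest k with k^3 <= n. *)
have exk : exists k, (k ^ 3 <= n)%N by exists 0%N.
have bnd k : (k ^ 3 <= n)%N -> (k <= n)%N.
  by apply: leq_trans; rewrite -[leqLHS]expn1; case: k => // k; rewrite leq_pexp2l.
case: (ex_maxnP exk bnd) => k kn kmax.
have Kk : (maxn K1 K2 <= k)%N by exact: kmax.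
have nk : (n < k.+1 ^ 3)%N by rewrite ltnNge; apply/negP => /kmax; rewrite ltnn.
have -> : l - x n = (l - x (k ^ 3)%N) + (x (k ^ 3)%N - x n) by rewrite addrA subrK.
apply: le_trans (ler_normD _ _) _; rewrite (splitr e); apply: lerD.
  by apply: hK1 => /=; apply: leq_trans Kk; exact: leq_maxl.
rewrite distrC; apply: le_trans (hx _ _ kn) _.
apply: le_trans (hK2 k (leq_trans (leq_maxr _ _) Kk)).
rewrite ler_pdivrMr ?ltr0n ?addn2// mulrAC ler_pdivlMr ?ltr0n//.
rewrite -!natrM ler_nat.
have : (n - k ^ 3 <= 3 * k.+1 ^ 2)%N by rewrite leq_subLR; nia.
move: (n - k ^ 3)%N => r hr.
apply: (@leq_trans (3 * k.+1 ^ 2 * k.+1)); first by rewrite leq_mul2r hr orbT.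
nia.
Qed.

(** * The transition operator and the first return to the origin *)

Section Chain.
Context {R : realType}.
Implicit Types (u v : nat) (a b : int) (f : nat -> nat -> int -> int -> R).

Definition left_share u v : R := u%:R / (u + v)%:R.
Definition right_share u v : R := v%:R / (u + v)%:R.

(** A walker away from 0 moves back surely, and the boolean summands charge this crossing to its
    edge. Every nonzero [a] other than -1 is treated as 1. *)
Definition jump (g : nat -> nat -> int -> R) u v a : R :=
  if a == 0 then
    left_share u v * g u.+1 v (-1) + right_share u v * g u v.+1 1
  else g (u + (a == -1)%R)%N (v + (a != -1)%R)%N 0.

(** The transition operator acts on functions: [step f] is the conditional expectation of [f] at the
    next state. *)
Definition step f u v a b : R :=
  2^-1 * (jump (fun u' v' a' => f u' v' a' b) u v a +
          jump (fun u' v' b' => f u' v' a b') u v b).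

Definition at_origin a b := (a == 0) && (b == 0).

(** The expectation of [f] at time [m] on the event that the first return to (0, 0) happens exactly
    then. The origin is tested only after a step, so the starting state does not count as a
    return. *)
Fixpoint first_return f m u v a b : R :=
  match m with
  | 0%N => 0
  | m'.+1 => step (fun u v a b => if at_origin a b then (m' == 0)%:R * f u v a b
                                  else first_return f m' u v a b) u v a b
  end.

Arguments first_return : simpl never.

Definition ratio u v (a b : int) : R := u%:R / (u + v)%:R.

Lemma left_shareE u v : (0 < u + v)%N -> left_share u v = 1 - right_share u v.
Proof.
move=> uv; rewrite /left_share /right_share natrD; apply/eqP; rewrite eq_sym subr_eq.
by rewrite -mulrDl -natrD divff// pnatr_eq0 -lt0n.
Qed.

Lemma step_ge0 f : (forall u v a b, 0 <= f u v a b) ->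
  forall u v a b, 0 <= step f u v a b.
Proof.
move=> f0; have j0 g u v a : (forall u v a, 0 <= g u v a) -> 0 <= jump g u v a.
  move=> g0; rewrite /jump; case: ifP => // _.
  by rewrite addr_ge0// mulr_ge0// divr_ge0.
by move=> u v a b; rewrite mulr_ge0// addr_ge0// j0.
Qed.

Lemma first_return_ge0 f m : (forall u v a b, 0 <= f u v a b) ->
  forall u v a b, 0 <= first_return f m u v a b.
Proof.
move=> f0; elim: m => [|m IH] u v a b; first by [].
by apply: step_ge0 => u' v' a' b'; case: ifP => // _; rewrite mulr_ge0.
Qed.

Lemma first_return0 f u v a b : first_return f 0 u v a b = 0.
Proof. by []. Qed.

Lemma first_return_step f m u v a b : first_return f m.+1 u v a b =
  step (fun u v a b => if at_origin a b then (m == 0)%:R * f u v a b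
                       else first_return f m u v a b) u v a b.
Proof. by []. Qed.

Lemma step00 f u v : step f u v 0 0 = 2^-1 *
  ((left_share u v * f u.+1 v (-1) 0 + right_share u v * f u v.+1 1 0) +
   (left_share u v * f u.+1 v 0 (-1) + right_share u v * f u v.+1 0 1)).
Proof. by []. Qed.

Lemma stepx0 f u v x : x != 0 -> step f u v x 0 = 2^-1 *
  (f (u + (x == -1)%R)%N (v + (x != -1)%R)%N 0 0 +
   (left_share u v * f u.+1 v x (-1) + right_share u v * f u v.+1 x 1)).
Proof. by rewrite /step /jump eqxx => /negbTE ->. Qed.

Lemma step0x f u v x : x != 0 -> step f u v 0 x = 2^-1 *
  ((left_share u v * f u.+1 v (-1) x + right_share u v * f u v.+1 1 x) +
   f (u + (x == -1)%R)%N (v + (x != -1)%R)%N 0 0).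
Proof. by rewrite /step /jump eqxx => /negbTE ->. Qed.

Lemma stepxy f u v x y : x != 0 -> y != 0 -> step f u v x y = 2^-1 *
  (f (u + (x == -1)%R)%N (v + (x != -1)%R)%N 0 y +
   f (u + (y == -1)%R)%N (v + (y != -1)%R)%N x 0).
Proof. by rewrite /step /jump => /negbTE -> /negbTE ->. Qed.

(** With one walker away, the next step is a return with probability 1/2. Otherwise both are away,
    and one further step restores the same kind of configuration. Each such cycle of two steps costs
    a factor 1/2, whatever the weights. *)
Lemma first_return_odd l u v (x : int) : (0 < u + v)%N -> x \in [:: -1; 1] ->
  first_return (fun _ _ _ _ => 1) l.*2.+1 u v x 0 = 2^-1 ^+ l.+1 /\
  first_return (fun _ _ _ _ => 1) l.*2.+1 u v 0 x = 2^-1 ^+ l.+1.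
Proof.
elim: l u v x => [|l IH] u v x uv hx.
  move: hx; rewrite !inE => /orP[] /eqP->;
  by rewrite !first_return_step stepx0// step0x// /at_origin /= !first_return0; split; ring.
(* From two walkers away, either move leaves exactly one away, so the value at 2l + 2 is that of the
   induction hypothesis at 2l + 1. *)
have H u' v' (y : int) : (0 < u' + v')%N -> y \in [:: -1; 1] ->
    first_return (fun _ _ _ _ => 1) l.*2.+2 u' v' x y = 2^-1 ^+ l.+1 /\
    first_return (fun _ _ _ _ => 1) l.*2.+2 u' v' y x = 2^-1 ^+ l.+1.
  move=> uv' hy.
  have [x0 y0] : x != 0 /\ y != 0.
    by split; [move: hx|move: hy]; rewrite !inE => /orP[] /eqP->.
  rewrite !first_return_step !stepxy// /at_origin !eqxx /= (negbTE x0) (negbTE y0) /=.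
  have h (z : int) : (0 < (u' + (z == -1)%R) + (v' + (z != -1)%R))%N by lia.
  rewrite (IH _ _ _ (h x) hy).2 (IH _ _ _ (h y) hx).1.
  by rewrite (IH _ _ _ (h y) hx).2 (IH _ _ _ (h x) hy).1 /=; split; field.
have x0 : x != 0 by move: hx; rewrite !inE => /orP[] /eqP->.
rewrite doubleS !(first_return_step _ l.*2.+2) stepx0// step0x// /at_origin !eqxx.
rewrite [-1 == 0]/= [1 == 0]/= !(negbTE x0) !andbF !mul0r /=.
have hl : (0 < u.+1 + v)%N by lia.
have hr : (0 < u + v.+1)%N by lia.
rewrite (H _ _ (-1) hl _).1 ?(H _ _ (-1) hl _).2 ?(H _ _ 1 hr _).1 ?(H _ _ 1 hr _).2//.
by rewrite left_shareE//; split; rewrite [in RHS]exprS; field.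
Qed.

Lemma first_return_origin l u v : (0 < u + v)%N ->
  first_return (fun _ _ _ _ => 1) l.+1.*2 u v 0 0 = 2^-1 ^+ l.+1.
Proof.
move=> uv; rewrite doubleS first_return_step step00 /at_origin !eqxx.
rewrite [-1 == 0]/= [1 == 0]/= /=.
have hl : (0 < u.+1 + v)%N by lia.
have hr : (0 < u + v.+1)%N by lia.
rewrite (@first_return_odd l _ _ (-1) hl _).1 ?(@first_return_odd l _ _ (-1) hl _).2//.
rewrite (@first_return_odd l _ _ 1 hr _).1 ?(@first_return_odd l _ _ 1 hr _).2//.
by rewrite left_shareE//; field.
Qed.

(** The total weight grows by one per step, so the expectation stays affine in [u] and [x = -1],
    with coefficients depending only on [l] and [s]. The normalisation is what later turns the
    average over the first jump into the initial ratio. *)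
Lemma first_return_ratio_odd l s : (0 < s)%N -> exists al be : R,
  al * s%:R + be = 1 /\ forall u v (x : int), (u + v)%N = s -> x \in [:: -1; 1] ->
  first_return ratio l.*2.+1 u v x 0 = 2^-1 ^+ l.+1 * (al * u%:R + be * (x == -1)%R%:R) /\
  first_return ratio l.*2.+1 u v 0 x = 2^-1 ^+ l.+1 * (al * u%:R + be * (x == -1)%R%:R).
Proof.
elim: l s => [|l IH] s s0.
  (* An immediate return by the walker at [x] gives the ratio (u + [x = -1]) / (s + 1). *)
  exists (s.+1%:R)^-1, (s.+1%:R)^-1; split.
    by rewrite -[X in _ + X]mulr1 -mulrDr natr1 mulVf// pnatr_eq0.
  move=> u v x uvs hx; have x0 : x != 0 by move: hx; rewrite !inE => /orP[] /eqP->.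
  rewrite !first_return_step stepx0// step0x// /at_origin !eqxx !(negbTE x0) !andbF /= !first_return0.
  rewrite /ratio; have -> : (u + (x == -1)%R + (v + (x != -1)%R))%N = s.+1 by lia.
  by rewrite natrD; move: (s.+1%:R^-1) => c; split; field.
have [al [be [E H]]] := IH _ (ltn_addr 2 s0).
(* With two walkers away, averaging over the one that moves back gives each owed left crossing the
   coefficient (al + be)/2. The walker at 0 goes left with probability u / s, which adds u / s to
   [u] and to the owed left crossings in mean. Collecting terms gives these coefficients. *)
exists (al * (1 + 3 / (2 * s%:R)) + be / (2 * s%:R)), (al / 2 + be / 2); split.
  by rewrite -[RHS]E natrD; field; rewrite pnatr_eq0 -lt0n.
move=> u v x uvs hx; have x0 : x != 0 by move: hx; rewrite !inE => /orP[] /eqP->.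
have G u' v' (y : int) : (u' + v')%N = s.+1 -> y \in [:: -1; 1] ->
    first_return ratio l.*2.+2 u' v' x y = 2^-1 ^+ l.+1 * (al * u'%:R + (al + be) / 2 * ((x == -1)%R%:R + (y == -1)%R%:R)) /\
    first_return ratio l.*2.+2 u' v' y x = 2^-1 ^+ l.+1 * (al * u'%:R + (al + be) / 2 * ((x == -1)%R%:R + (y == -1)%R%:R)).
  move=> uv' hy; have y0 : y != 0 by move: hy; rewrite !inE => /orP[] /eqP->.
  rewrite !first_return_step !stepxy// /at_origin !eqxx /= (negbTE x0) (negbTE y0) /=.
  have h (z : int) : ((u' + (z == -1)%R) + (v' + (z != -1)%R))%N = (s + 2)%N by lia.
  rewrite (H _ _ _ (h x) hy).2 (H _ _ _ (h y) hx).1.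
  by rewrite (H _ _ _ (h y) hx).2 (H _ _ _ (h x) hy).1 /= !natrD; split; field.
rewrite doubleS !(first_return_step _ l.*2.+2) stepx0// step0x// /at_origin !eqxx.
rewrite [-1 == 0]/= [1 == 0]/= !(negbTE x0) !andbF !mul0r /=.
have hl : (u.+1 + v)%N = s.+1 by lia.
have hr : (u + v.+1)%N = s.+1 by lia.
rewrite (G _ _ (-1) hl _).1 ?(G _ _ (-1) hl _).2 ?(G _ _ 1 hr _).1 ?(G _ _ 1 hr _).2//.
rewrite -[u.+1]addn1 natrD; have s0' : s%:R != 0 :> R by rewrite pnatr_eq0 -lt0n.
have -> : right_share u v = 1 - left_share u v :> R by rewrite left_shareE ?uvs//; ring.
rewrite /left_share uvs eqxx [1 == -1]/= ![2^-1 ^+ l.+2]exprS.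
by split => /=; field.
Qed.

(** Up to the factor 2^-(l+1), averaging the affine form over the first jump gives u / (u + v) times
    al (u + v + 1) + be, and the last factor is 1. *)
Lemma first_return_ratio l u v : (0 < u + v)%N ->
  first_return ratio l.+1.*2 u v 0 0 = 2^-1 ^+ l.+1 * ratio u v 0 0.
Proof.
move=> uv; rewrite doubleS first_return_step step00 /at_origin !eqxx.
rewrite [-1 == 0]/= [1 == 0]/= /=.
have [al [be [E H]]] := @first_return_ratio_odd l (u + v).+1 isT.
have hl : (u.+1 + v)%N = (u + v).+1 by lia.
have hr : (u + v.+1)%N = (u + v).+1 by lia.
rewrite (H _ _ (-1) hl _).1 ?(H _ _ (-1) hl _).2 ?(H _ _ 1 hr _).1 ?(H _ _ 1 hr _).2//.
have -> : right_share u v = 1 - left_share u v :> R by rewrite left_shareE//; ring.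
rewrite /left_share /ratio eqxx [1 == -1]/= -[u.+1]addn1 natrD.
rewrite -[X in _ = _ * X]mulr1 -[X in _ = _ * (_ * X)]E -[(u + v).+1]addn1 !natrD /=.
by field; rewrite -natrD pnatr_eq0 -lt0n.
Qed.

End Chain.

(** * Variance of the completed ratio *)

Section Completed.
Context {R : realType}.
Implicit Types (u v : nat) (a b : int).

(* [ratio] with the return crossings owed by the walkers away from 0 counted in
   advance; its one-step drift is O(1/n^2) while that of [ratio] is O(1/n). *)
Definition completed_ratio u v a b : R :=
  (u + ((a == -1)%R + (b == -1)%R))%:R /
  (u + v + ((a == -1)%R + (b == -1)%R) + ((a == 1)%R + (b == 1)%R))%:R.

Lemma completed_ratioC u v a b : completed_ratio u v a b = completed_ratio u v b a.
Proof.
by rewrite /completed_ratio [((a == -1)%R + _)%N]addnC [((a == 1)%R + _)%N]addnC.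
Qed.

(** The left side is the mean of (x' - c)^2 when the ratio [x] moves towards 1 or 0 by the fraction
    [h]. For p = x there is no drift; here the drift costs at most 2 h |p - x| <= 4 / s^2, and the
    squared step at most 2 h^2 <= 8 / s^2. *)
Lemma urn_variance (x p s h c : R) : 0 <= x <= 1 -> 0 <= p <= 1 -> 0 <= c <= 1 ->
  0 < s -> `|p - x| <= s^-1 -> 0 <= h <= 2 / s ->
  p * (x + h * (1 - x) - c) ^+ 2 + (1 - p) * (x - h * x - c) ^+ 2 <=
  (x - c) ^+ 2 + 12 / s ^+ 2.
Proof.
move=> /andP[x0 x1] /andP[p0 p1] /andP[c0 c1] s0 px /andP[h0 h2].
have -> : p * (x + h * (1 - x) - c) ^+ 2 + (1 - p) * (x - h * x - c) ^+ 2 =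
  (x - c) ^+ 2 + (2 * h * ((x - c) * (p - x)) +
     h ^+ 2 * (p * (1 - x) ^+ 2 + (1 - p) * x ^+ 2)) by ring.
rewrite lerD2l.
have -> : 12 / s ^+ 2 = 2 * (2 / s) * s^-1 + (2 / s) ^+ 2 * 2 by field; rewrite gt_eqF.
have si : 0 <= s^-1 by rewrite invr_ge0 ltW.
apply: lerD.
  apply: (@le_trans _ _ (2 * h * s^-1)).
    rewrite ler_wpM2l ?mulr_ge0//; apply: le_trans (ler_norm _) _.
    rewrite normrM -[leRHS]mul1r ler_pM//.
    by rewrite ler_norml; apply/andP; split; lra.
  by rewrite ler_wpM2r// ler_wpM2l.
apply: ler_pM => //; first exact: sqr_ge0.
- by rewrite addr_ge0// mulr_ge0 ?sqr_ge0//; lra.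
- by rewrite lerXn2r// nnegrE// divr_ge0// ltW.
- by nra.
Qed.

(** A walker moving back to 0 makes a crossing already counted, so nothing changes. A walker leaving
    0 adds two units on one side, its crossing and the return it now owes: an urn step. *)
Lemma jump_completed_ratio u v a b (c : R) : (0 < u + v)%N ->
  a \in [:: -1; 0; 1] -> b \in [:: -1; 0; 1] -> 0 <= c <= 1 ->
  jump (fun u' v' a' => (completed_ratio u' v' a' b - c) ^+ 2) u v a <=
  (completed_ratio u v a b - c) ^+ 2 + 12 / (u + v)%:R ^+ 2.
Proof.
move=> uv ha hb hc.
have s0 : 0 < (u + v)%:R :> R by rewrite ltr0n.
have [->|a0] := eqVneq a 0; last first.
  have -> : jump (fun u' v' a' => (completed_ratio u' v' a' b - c) ^+ 2) u v a =
      (completed_ratio u v a b - c) ^+ 2.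
    rewrite /jump (negbTE a0) /completed_ratio.
    move: ha a0; rewrite !inE => /or3P[] /eqP-> // _; rewrite /=;
    by congr ((_%:R / _%:R - _) ^+ 2); lia.
  by rewrite lerDl divr_ge0// exprn_ge0// ltW.
rewrite /jump eqxx.
have -> : right_share u v = 1 - left_share u v :> R by rewrite left_shareE//; ring.
(* [w] is the crossing owed by the other walker. Being at most 1, it separates the jump probability
   from the completed ratio by at most 1 / (u + v). *)
set w := ((b == -1)%R + (b == 1)%R)%N.
have w1 : (w <= 1)%N by rewrite /w; move: hb; rewrite !inE => /or3P[] /eqP->.
set x := completed_ratio u v 0 b.
have sw' : (0 < u + v + w)%N by lia.
have sw0 : (0 : R) < (u + v + w)%:R by rewrite ltr0n.
have xE : x = (u + (b == -1)%R)%:R / (u + v + w)%:R.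
  by rewrite /x /completed_ratio /w /= add0n; congr (_ / _%:R); lia.
(* Two units are added to a completed total of u + v + w. *)
pose h : R := 2 / (u + v + w + 2)%:R.
have e1 : completed_ratio u.+1 v (-1) b = x + h * (1 - x).
  rewrite /completed_ratio /= xE /h.
  have -> : (u.+1 + (1 + (b == -1)%R) = (u + (b == -1)%R) + 2)%N by lia.
  have -> : (u.+1 + v + (1 + (b == -1)%R) + (0 + (b == 1)%R) = (u + v + w) + 2)%N by rewrite /w; lia.
  by move: (u + v + w)%N sw' => t t0; rewrite !natrD; field; rewrite -?natrD ?pnatr_eq0; apply/andP; split; lia.
have e2 : completed_ratio u v.+1 1 b = x - h * x.
  rewrite /completed_ratio /= xE /h.
  have -> : (u + (0 + (b == -1)%R) = (u + (b == -1)%R))%N by lia.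
  have -> : (u + v.+1 + (0 + (b == -1)%R) + (1 + (b == 1)%R) = (u + v + w) + 2)%N by rewrite /w; lia.
  by move: (u + v + w)%N sw' => t t0; rewrite !natrD; field; rewrite -?natrD ?pnatr_eq0; apply/andP; split; lia.
rewrite e1 e2; apply: urn_variance => //.
- rewrite xE divr_ge0//= ler_pdivrMr// mul1r ler_nat /w; lia.
- by rewrite /left_share divr_ge0//= ler_pdivrMr// mul1r ler_nat; lia.
- rewrite xE /left_share.
  have -> : u%:R / (u + v)%:R - (u + (b == -1)%R)%:R / (u + v + w)%:R =
     (u%:R * w%:R - (b == -1)%R%:R * (u + v)%:R) / (u + v + w)%:R / (u + v)%:R :> R.
    rewrite natrD (natrD _ (u + v) w); field.
    by rewrite -!natrD !pnatr_eq0; apply/andP; split; lia.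
  rewrite normrM normfV (ger0_norm (ltW s0)) ler_pdivrMr// (mulVf (lt0r_neq0 s0)).
  rewrite normrM normfV (ger0_norm (ltW sw0)) ler_pdivrMr// mul1r.
  rewrite -!natrM ler_norml; apply/andP; split.
    rewrite lerBrDr addrC lerBlDr -natrD ler_nat.
    by case: (b == -1); rewrite ?mul1n ?mul0n; nia.
  rewrite lerBlDr -natrD ler_nat; have : (u * w <= u)%N by rewrite -[leqRHS]muln1 leq_mul2l w1 orbT.
  move=> uw; apply: leq_trans uw _; by rewrite -!addnA leq_addr.
- rewrite /h divr_ge0//= ler_wpM2l// lef_pV2 ?posrE ?ler_nat ?ltr0n//; lia.
Qed.

Lemma step_completed_ratio u v a b (c : R) : (0 < u + v)%N ->
  a \in [:: -1; 0; 1] -> b \in [:: -1; 0; 1] -> 0 <= c <= 1 ->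
  step (fun u v a b => (completed_ratio u v a b - c) ^+ 2) u v a b <=
  (completed_ratio u v a b - c) ^+ 2 + 12 / (u + v)%:R ^+ 2.
Proof.
move=> uv ha hb hc; rewrite /step mulrC ler_pdivrMr// mulrDr mulr1.
apply: lerD; first exact: jump_completed_ratio.
rewrite [X in (X - c) ^+ 2 + _]completed_ratioC.
have -> : (fun u' v' b' => (completed_ratio u' v' a b' - c) ^+ 2) =
          (fun u' v' b' => (completed_ratio u' v' b' a - c) ^+ 2).
  by do 3 apply/funext => ?; rewrite completed_ratioC.
exact: jump_completed_ratio.
Qed.

End Completed.

(** * The two-walker process *)

Section Process.
Set Implicit Arguments.
Unset Strict Implicit.
Unset Printing Implicit Defensive.
Context {R : realType} {d : measure_display} {T : measurableType d}.
Variables (P : probability T R).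
Variables (X : 'I_2 -> nat -> T -> int) (sel : nat -> T -> 'I_2).
Hypothesis hX : two_walkers P X sel.

Let k0 : 'I_2 := ord0.
Let k1 : 'I_2 := ord_max.

(** * Histories as countably many atoms *)

Lemma ord2P (k : 'I_2) : k = k0 \/ k = k1.
Proof. by case: k => -[|[]]// i; [left|right]; exact/val_inj. Qed.

Definition agree n w w' :=
  (forall k i, (i <= n)%N -> X k i w = X k i w') /\
  (forall i, (i < n)%N -> sel i w = sel i w').

(** This replaces membership in the sigma-algebra of the history up to time [n]; measurability
    follows because there are only countably many histories. *)
Definition determined n (A : set T) := forall w w', agree n w w' -> A w -> A w'.

(** A numbering of histories by [nat], so that they form a countable measurable partition. *)
Definition code n w : nat :=
  pickle ([seq (X k0 i w, X k1 i w) | i <- iota 0 n.+1],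
          [seq sel i w | i <- iota 0 n]).

Lemma agree_sym n w w' : agree n w w' -> agree n w' w.
Proof. by move=> [a b]; split=> *; rewrite ?a ?b. Qed.

Lemma agreeW m n w w' : (m <= n)%N -> agree n w w' -> agree m w w'.
Proof.
move=> mn [a b]; split=> *; [apply: a|apply: b].
  exact: leq_trans mn.
exact: leq_trans mn.
Qed.

Lemma codeP n w w' : code n w = code n w' <-> agree n w w'.
Proof.
split=> [/(pcan_inj pickleK)/pair_equal_spec[e1 e2]|[a b]]; last first.
  congr pickle; congr pair; apply/eq_in_map => i; rewrite mem_iota add0n => /andP[_ ?].
    by rewrite !a.
  exact: b.
have E1 i : (i <= n)%N -> (X k0 i w, X k1 i w) = (X k0 i w', X k1 i w').
  by move=> ni; move/eq_in_map : e1; apply; rewrite mem_iota.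
split=> [k i /E1[??]|i ni]; first by case: (ord2P k) => ->.
by move/eq_in_map : e2; apply; rewrite mem_iota.
Qed.

Lemma historyE n w0 : history X sel n (fun k i => X k i w0) (sel^~ w0) =
  [set w | agree n w w0].
Proof. by []. Qed.

Lemma atom_measurable n w0 : measurable [set w | agree n w w0].
Proof.
have -> : [set w | agree n w w0] =
    \bigcap_(i in [set i | (i <= n)%N]) [set w | X k0 i w = X k0 i w0] `&`
    \bigcap_(i in [set i | (i <= n)%N]) [set w | X k1 i w = X k1 i w0] `&`
    \bigcap_(i in [set i | (i < n)%N]) [set w | sel i w = sel i w0].
  apply/seteqP; split=> [w [a b]|w [[a a'] b]].
    by split; [split|] => i ni /=; [exact: a|exact: a|exact: b].
  by split=> // k i ni; case: (ord2P k) => ->; [exact: a|exact: a'].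
by apply: measurableI; [apply: measurableI|]; apply: bigcap_measurableType => i _;
  [exact: walker_measurable hX _ _ _|exact: walker_measurable hX _ _ _
  |exact: choice_measurable hX _ _].
Qed.

Lemma determinedI n A B : determined n A -> determined n B -> determined n (A `&` B).
Proof. by move=> a b w w' e [/a ? /b ?]; split; eauto. Qed.

Lemma determinedC n A : determined n A -> determined n (~` A).
Proof. by move=> a w w' /agree_sym e Aw /(a _ _ e). Qed.

Lemma determinedW m n A : (m <= n)%N -> determined m A -> determined n A.
Proof. by move=> mn a w w' /(agreeW mn); exact: a. Qed.

Lemma code_partition n A : A = \bigcup_i (A `&` [set w | code n w = i]).
Proof. by apply/seteqP; split=> [w Aw|w [i _ []//]]; exists (code n w). Qed.

Lemma trivIset_code n A : trivIset setT (fun i => A `&` [set w | code n w = i]).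
Proof. by move=> i j _ _ [w [[_ <-] [_ <-]]]. Qed.

Lemma determined_code n A i : determined n A ->
  A `&` [set w | code n w = i] = set0 \/
  exists2 w0, A w0 & A `&` [set w | code n w = i] = [set w | agree n w w0].
Proof.
move=> dA; have [->|/set0P[w0 [Aw0 <-]]] := eqVneq (A `&` [set w | code n w = i]) set0.
  by left.
right; exists w0 => //; apply/seteqP; split=> [w [_ /codeP//]|w h].
by split; [exact: dA (agree_sym h) Aw0|exact/codeP].
Qed.

Lemma determined_code_measurable n A i : determined n A ->
  measurable (A `&` [set w | code n w = i]).
Proof. by move=> /determined_code - /(_ i)[->//|[w0 _ ->]]; exact: atom_measurable. Qed.

Lemma determined_measurable n A : determined n A -> measurable A.
Proof.
move=> dA; rewrite (code_partition n A); apply: bigcup_measurable => i _.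
exact: determined_code_measurable.
Qed.

Lemma determined_measurable_fun n d' (U : measurableType d') (g : T -> U) :
  (forall w w', agree n w w' -> g w = g w') -> measurable_fun setT g.
Proof.
move=> dg _ B mB; rewrite setTI; apply: (@determined_measurable n) => w w' e /=.
by rewrite (dg _ _ e).
Qed.

Lemma integral_atoms n A (f g : T -> \bar R) : determined n A ->
  measurable_fun setT f -> measurable_fun setT g ->
  (forall w, 0 <= f w)%E -> (forall w, 0 <= g w)%E ->
  (forall w0, \int[P]_(w in [set w | agree n w w0]) f w =
              \int[P]_(w in [set w | agree n w w0]) g w)%E ->
  (\int[P]_(w in A) f w = \int[P]_(w in A) g w)%E.
Proof.
move=> dA mf mg f0 g0 fg; rewrite (code_partition n A).
rewrite !ge0_integral_bigcup//; try exact: trivIset_code;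
  try (by move=> k; exact: determined_code_measurable);
  try exact: (measurable_funS measurableT).
apply: eq_eseriesr => i _.
by have [->|[w0 _ ->]] := determined_code i dA; rewrite ?integral_set0.
Qed.

(** * The state of the chain and its one-step expectation *)

Definition left_weight n w := weight (fun k i => X k i w) n (-1).
Definition right_weight n w := weight (fun k i => X k i w) n 0.

Definition state_fun n w (f : nat -> nat -> int -> int -> R) : R :=
  f (left_weight n w) (right_weight n w) (X k0 n w) (X k1 n w).

Lemma agree_weight n w w' l : agree n w w' ->
  weight (fun k i => X k i w) n l = weight (fun k i => X k i w') n l.
Proof.
move=> [a _]; rewrite /weight /crossings; congr addn.
apply: eq_bigr => k _; apply: eq_big_nat => i /andP[i0 ni].
by rewrite !a//; lia.
Qed.

Lemma agree_state n w w' : agree n w w' -> state_fun n w = state_fun n w'.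
Proof.
move=> h; apply/funext => f.
by rewrite /state_fun /left_weight /right_weight !(agree_weight _ h) !h.1.
Qed.

Lemma weightS n w l (k : 'I_2) : sel n w = k ->
  weight (fun k i => X k i w) n.+1 l =
  (weight (fun k i => X k i w) n l + crosses (X k n w) (X k n.+1 w) l)%N.
Proof.
move=> sk; rewrite /weight /crossings -addnA; congr addn.
rewrite (bigD1 k)//= [in RHS](bigD1 k)//= big_nat_recr//= addnAC; congr (_ + _ + _)%N.
apply: eq_bigr => j jk; rewrite big_nat_recr//=.
rewrite (walker_stay hX) ?sk//.
suff -> : crosses (X j n w) (X j n w) l = false by rewrite addn0.
by rewrite /crosses; case: eqP => [->|_]/=; [case: eqP => //|case: eqP => //=]; lia.
Qed.

Lemma integral_split (A B : set T) (f : T -> \bar R) : measurable A -> measurable B ->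
  measurable_fun setT f -> (forall w, 0 <= f w)%E ->
  (\int[P]_(w in A) f w = \int[P]_(w in A `&` B) f w + \int[P]_(w in A `&` ~` B) f w)%E.
Proof.
move=> mA mB mf f0; rewrite -{1}(setUIDK A B) setDE ge0_integral_setU//.
- exact: measurableI.
- by apply: measurableI => //; exact: measurableC.
- exact: measurable_funS mf.
- by apply/disj_setPS => w [[_ ?] [_]].
Qed.

Definition next_state n w (k : 'I_2) (y : int)
    (f : nat -> nat -> int -> int -> R) : R :=
  f (left_weight n w + crosses (X k n w) y (-1))%N
    (right_weight n w + crosses (X k n w) y 0)%N
    (if k == k0 then y else X k0 n w) (if k == k1 then y else X k1 n w).

Section Step.
Variables (n : nat) (F : T -> nat -> nat -> int -> int -> R).
Hypothesis F0 : forall w u v a b, 0 <= F w u v a b.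
Hypothesis dF : forall w w', agree n w w' -> F w = F w'.

Lemma determined_next : measurable_fun setT (fun w => (state_fun n.+1 w (F w))%:E).
Proof.
apply: (@determined_measurable_fun n.+1) => w w' e.
by rewrite (agree_state e) (dF (agreeW (leqnSn n) e)).
Qed.

Lemma determined_step : measurable_fun setT (fun w => (state_fun n w (step (F w)))%:E).
Proof.
by apply: (@determined_measurable_fun n) => w w' e; rewrite (agree_state e) (dF e).
Qed.

(** On this piece the next state is constant, and the two laws of the model give its mass as 1/2
    times the jump probability times the mass of the atom. *)
Lemma integral_next_piece w0 k y :
  (\int[P]_(w in [set w | agree n w w0] `&` [set w | sel n w = k]
             `&` [set w | X k n.+1 w = y]) (state_fun n.+1 w (F w))%:E =
   (2^-1 * (jump_prob (fun k i => X k i w0) n k y * next_state n w0 k y (F w0)))%:E *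
    P [set w | agree n w w0])%E.
Proof.
rewrite (eq_integral (cst (next_state n w0 k y (F w0))%:E)); last first.
  move=> w; rewrite inE => -[[/= e sk] yk]; congr EFin.
  rewrite /state_fun /next_state /left_weight /right_weight !(weightS _ sk) yk.
  rewrite !(agree_weight _ e) !(e.1 k n)// (dF e).
  congr (F _ _ _ _ _).
    case: (eqVneq k k0) => [<-//|kk]; rewrite (walker_stay hX) ?sk 1?eq_sym//.
    exact: e.1.
  case: (eqVneq k k1) => [<-//|kk]; rewrite (walker_stay hX) ?sk 1?eq_sym//.
  exact: e.1.
rewrite integral_cst; last first.
  apply: measurableI; first apply: measurableI.
  - exact: atom_measurable.
  - exact: choice_measurable hX _ _.
  - exact: walker_measurable hX _ _ _.
have E := walker_jump hX n (fun k i => X k i w0) (sel^~ w0) k y.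
rewrite (choice_uniform hX) historyE in E.
rewrite [X in (_ * X)%E = _]E !muleA -!EFinM.
by congr (_%:E * _)%E; ring.
Qed.

(** Impossible jumps carry the factor 0, so summing over all three vertices yields the operator. *)
Lemma jump_prob_jump w0 k (g : nat -> nat -> int -> R) :
  let c y := jump_prob (fun k i => X k i w0) n k y *
    g (left_weight n w0 + crosses (X k n w0) y (-1))%N
      (right_weight n w0 + crosses (X k n w0) y 0)%N y in
  c (-1) + (c 0 + c 1) = jump g (left_weight n w0) (right_weight n w0) (X k n w0).
Proof.
have := walker_vertex hX k n w0; rewrite /jump_prob /jump !inE.
move=> /or3P[] /eqP->; rewrite /= /crosses /=.
- by rewrite !mul0r !add0r mul1r addr0 addn0 addn1.
- by rewrite mul0r add0r !addn1 !addn0.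
- by rewrite !mul0r !add0r mul1r addr0 addn0 addn1.
Qed.

(** The Markov property, checked atom by atom. The function may depend on the history, which allows
    squared distances to an earlier value. *)
Lemma integral_step A : determined n A ->
  (\int[P]_(w in A) (state_fun n.+1 w (F w))%:E =
   \int[P]_(w in A) (state_fun n w (step (F w)))%:E)%E.
Proof.
move=> dA; have step0 w : 0 <= state_fun n w (step (F w)).
  by rewrite /state_fun step_ge0//.
apply: (integral_atoms dA determined_next determined_step) => [w|w|w0].
- by rewrite lee_fin /state_fun.
- by rewrite lee_fin.
set H := [set w | agree n w w0].
have mH : measurable H by exact: atom_measurable.
have mk k : measurable [set w | sel n w = k] by exact: choice_measurable hX _ _.
have my k y : measurable [set w | X k n.+1 w = y] by exact: walker_measurable hX _ _ _.
have PH : P H \is a fin_num by exact: fin_num_measure.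
pose f w := (state_fun n.+1 w (F w))%:E.
have f0 w : (0 <= f w)%E by rewrite lee_fin /state_fun.
pose x0 := (fun k i => X k i w0).
have Hk k : (\int[P]_(w in H `&` [set w | sel n w = k]) f w =
    (2^-1 * (jump_prob x0 n k (-1) * next_state n w0 k (-1) (F w0) +
    (jump_prob x0 n k 0 * next_state n w0 k 0 (F w0) +
     jump_prob x0 n k 1 * next_state n w0 k 1 (F w0))))%:E * P H)%E.
  have mHk : measurable (H `&` [set w | sel n w = k]) by exact: measurableI.
  rewrite (integral_split mHk (my k (-1)) determined_next f0) integral_next_piece.
  have mHk' := measurableI _ _ mHk (measurableC (my k (-1))).
  rewrite (integral_split mHk' (my k 0) determined_next f0).
  have -> : H `&` [set w | sel n w = k] `&` ~` [set w | X k n.+1 w = -1] `&`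
      [set w | X k n.+1 w = 0] =
      H `&` [set w | sel n w = k] `&` [set w | X k n.+1 w = 0].
    by apply/seteqP; split=> [w [[? _] ?]|w [? /= e]]//; split=> //; split=> //= ; rewrite e.
  have -> : H `&` [set w | sel n w = k] `&` ~` [set w | X k n.+1 w = -1] `&`
      ~` [set w | X k n.+1 w = 0] =
      H `&` [set w | sel n w = k] `&` [set w | X k n.+1 w = 1].
    apply/seteqP; split=> [w [[? /= h1] /= h0]|w [? /= e]]; last first.
      by split; [split=> //=|]; rewrite ?e//= e.
    split=> //=; have := walker_vertex hX k n.+1 w.
    by rewrite !inE => /or3P[] /eqP e //; case: (h1, h0) => ? ?; contradiction.
  by rewrite !integral_next_piece -!muleDl// -!EFinD -!mulrDr.
rewrite -[LHS]/(\int[P]_(w in H) f w)%E.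
rewrite (integral_split mH (mk k0) (determined_next : measurable_fun setT f) f0) Hk.
have -> : H `&` ~` [set w | sel n w = k0] = H `&` [set w | sel n w = k1].
  apply/seteqP; split=> w [Hw /= h]; split=> //=; last by rewrite h.
  by case: (ord2P (sel n w)).
rewrite Hk -muleDl// -EFinD -mulrDr.
rewrite (eq_integral (cst (state_fun n w0 (step (F w0)))%:E)); last first.
  by move=> w; rewrite inE => /= e; rewrite (agree_state e) (dF e).
rewrite integral_cst//; congr (_%:E * _)%E.
rewrite /state_fun /step; congr (_ * (_ + _)).
  exact: (jump_prob_jump w0 k0 (fun u v a => F w0 u v a (X k1 n w0))).
exact: (jump_prob_jump w0 k1 (fun u v b => F w0 u v (X k0 n w0) b)).
Qed.

End Step.

(** * First returns to the origin *)

Definition origin n w := at_origin (X k0 n w) (X k1 n w).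

(** The time [t] need not be a common visit to 0; this allows a recursion that advances [t]. *)
Definition return_in t m : set T := [set w | [/\ (0 < m)%N, origin (t + m) w &
  forall i, (0 < i < m)%N -> ~~ origin (t + i) w]].

Lemma agree_origin n w w' : agree n w w' -> origin n w = origin n w'.
Proof. by move=> h; rewrite /origin !h.1. Qed.

Lemma determined_origin n : determined n [set w | origin n w].
Proof. by move=> w w' /agree_origin /= ->. Qed.

Lemma determined_return t m : determined (t + m) (return_in t m).
Proof.
move=> w w' e [m0 o h]; split => //; first by rewrite -(agree_origin e).
move=> i im; rewrite -(agree_origin (agreeW _ e)) ?h//; lia.
Qed.

Lemma return_in0 t : return_in t 0 = set0.
Proof. by apply/seteqP; split=> // w []. Qed.

Lemma return_in1 t : return_in t 1 = [set w | origin t.+1 w].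
Proof.
apply/seteqP; split=> w; first by case; rewrite addn1.
by move=> o; split => //; [rewrite addn1|case=> [|i]//; rewrite ltnS andbC].
Qed.

Lemma return_inS t m : return_in t m.+2 = ~` [set w | origin t.+1 w] `&` return_in t.+1 m.+1.
Proof.
apply/seteqP; split=> w.
  move=> [_ o h]; split; first by move: (h 1%N isT); rewrite addn1 => /negP.
  split=> //; first by rewrite addSnnS.
  by move=> i im; rewrite addSnnS; apply: h; lia.
move=> [/negP o1 [_ o h]]; split=> //; first by rewrite -addSnnS.
case=> [//|[|i]] im; first by rewrite addn1.
by rewrite -addSnnS; apply: h; lia.
Qed.

Lemma state_measurable n (f : nat -> nat -> int -> int -> R) :
  measurable_fun setT (fun w => (state_fun n w f)%:E).
Proof. by apply: (@determined_measurable_fun n) => w w' /agree_state ->. Qed.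

Lemma origin_measurable n : measurable [set w | origin n w].
Proof. exact: (determined_measurable (determined_origin (n := n))). Qed.

(** Induction on [m]: [integral_step] exposes the state at t + 1, and the event is restricted to
    paths not at the origin there, as in the recursion of [first_return]. *)
Lemma integral_return f A t m : (forall u v a b, 0 <= f u v a b) -> determined t A ->
  (\int[P]_(w in A `&` return_in t m) (state_fun (t + m) w f)%:E =
   \int[P]_(w in A) (state_fun t w (first_return f m))%:E)%E.
Proof.
move=> f0; elim: m A t => [|m IH] A t dA.
  by rewrite return_in0 setI0 integral_set0 integral0_eq.
pose G u v a b := if at_origin a b then (m == 0)%:R * f u v a b
                  else first_return f m u v a b.
have G0 u v a b : 0 <= G u v a b.
  by rewrite /G; case: ifP => _; [rewrite mulr_ge0|exact: first_return_ge0].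
rewrite [RHS](_ : _ = \int[P]_(w in A) (state_fun t w (step G))%:E)%E//.
rewrite -(@integral_step t (fun=> G))//.
have dA' := determinedW (leqnSn t) dA; have mA' := determined_measurable dA'.
rewrite (integral_split mA' (origin_measurable t.+1) (state_measurable _ _)); last first.
  by move=> w; rewrite lee_fin /state_fun.
(* For a return at the next step only the part at the origin contributes; for a later one, only its
   complement. *)
case: m IH @G G0 => [|m] IH G G0.
  rewrite return_in1 [X in (_ + X)%E]integral0_eq ?adde0; last first.
    move=> w [_ /= /negP o]; rewrite /state_fun /G ifF//.
    by apply/negbTE; exact: o.
  apply: eq_integral => w; rewrite inE => -[_ /= o].
  by rewrite /state_fun /G addn1 ifT// mul1r.
rewrite [X in (X + _)%E]integral0_eq ?add0e; last first.
  by move=> w [_ /= o]; rewrite /state_fun /G ifT// mul0r.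
rewrite return_inS setIA -addSnnS IH; last first.
  apply: determinedI dA' _; apply: determinedC; exact: determined_origin.
apply: eq_integral => w; rewrite inE => -[_ /= /negP o].
by rewrite /state_fun /G ifF//; apply/negbTE; exact: o.
Qed.

(* The halving of the integral at each possible return time holds for both
   [f = 1] and [f = ratio]. *)
Lemma integral_return_origin f A t l : (forall u v a b, 0 <= f u v a b) ->
  (forall u v, (0 < u + v)%N -> first_return f l.+1.*2 u v 0 0 = 2^-1 ^+ l.+1 * f u v 0 0) ->
  determined t A -> A `<=` [set w | origin t w] ->
  (\int[P]_(w in A `&` return_in t l.+1.*2) (state_fun (t + l.+1.*2) w f)%:E =
   (2^-1 ^+ l.+1)%:E * \int[P]_(w in A) (state_fun t w f)%:E)%E.
Proof.
move=> f0 fh dA Ao; have mA := determined_measurable dA.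
rewrite integral_return// -ge0_integralZl//; last 2 first.
- apply: (measurable_funS measurableT (@subsetT _ _)); exact: state_measurable.
- by move=> w _; rewrite lee_fin /state_fun.
apply: eq_integral => w; rewrite inE => /Ao /andP[/eqP a /eqP b].
by rewrite -EFinM /state_fun a b fh.
Qed.

(** * The times [tau] as stopping times *)

Lemma originP n w : origin n w <-> forall k, X k n w = 0.
Proof.
split=> [/andP[/eqP a /eqP b] k|h]; first by case: (ord2P k) => ->.
by rewrite /origin /at_origin !h eqxx.
Qed.

Lemma ereal_inf_nat (Q : set nat) m : Q m -> (forall i, Q i -> (m <= i)%N) ->
  ereal_inf [set (i%:R : R)%:E | i in Q] = (m%:R)%:E.
Proof.
move=> Qm h; apply/eqP; rewrite eq_le; apply/andP; split.
  by apply: ereal_inf_lbound; exists m.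
by apply: le_ereal_inf_tmp => _ [i Qi <-]; rewrite lee_fin ler_nat h.
Qed.

Local Notation tau := (@Defs.tau T R X).

Lemma tauS n w : tau n.+1 w = ereal_inf [set ((m%:R : R)%:E) | m in
  [set m : nat | (tau n w < (m%:R)%:E)%E /\ forall k, X k m w = 0]].
Proof. by []. Qed.

Lemma tau_next n t m w : tau n w = (t%:R)%:E -> return_in t m w ->
  tau n.+1 w = ((t + m)%:R)%:E.
Proof.
move=> e [m0 o h]; rewrite tauS e; apply: ereal_inf_nat => [|i [ti /originP oi]].
  split; last exact/originP.
  by rewrite lte_fin ltr_nat -[ltnLHS]addn0 ltn_add2l.
rewrite lte_fin ltr_nat in ti.
rewrite leqNgt; apply/negP => im; have := h (i - t)%N.
by rewrite subnKC ?(ltnW ti)// oi => /(_ ltac:(lia)).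
Qed.

Lemma tau_next_pinfty n w : tau n w = +oo%E -> tau n.+1 w = +oo%E.
Proof.
move=> e; rewrite tauS e (_ : [set _ | _ in _] = set0) ?ereal_inf0//.
by apply/seteqP; split=> // x [m [+ _] _]; rewrite ltNge leey.
Qed.

Lemma tau_next_fin n t w : tau n w = (t%:R)%:E ->
  tau n.+1 w = +oo%E \/ exists m, return_in t m w.
Proof.
move=> e; have [[m mo]|no] := pselect (exists m, origin (t + m.+1) w); [right|left].
  have ex : exists m, origin (t + m.+1) w by exists m.
  exists (ex_minn ex).+1; case: ex_minnP => k ko kmin; split=> // -[//|i] /andP[_ ik].
  by apply/negP => /kmin; lia.
rewrite tauS e (_ : [set _ | _ in _] = set0) ?ereal_inf0//.
apply/seteqP; split=> // x [m [+ /originP om] _]; rewrite lte_fin ltr_nat => tm.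
by apply: no; exists (m - t.+1)%N; rewrite addnS -addSn subnKC.
Qed.

Lemma tauP n w : tau n w = +oo%E \/ exists2 t, tau n w = (t%:R)%:E & origin t w.
Proof.
elim: n => [|n [/tau_next_pinfty|[t e ot]]].
- by right; exists 0%N => //; apply/originP => k; exact: walker_start hX _ _.
- by left.
- have [|[m r]] := tau_next_fin e; first by left.
  by right; exists (t + m)%N; [exact: tau_next|case: r].
Qed.

Lemma tau_nextP n s w : tau n.+1 w = (s%:R)%:E ->
  exists t m, [/\ tau n w = (t%:R)%:E, return_in t m w & s = (t + m)%N].
Proof.
move=> e; have [/tau_next_pinfty|[t te _]] := tauP n w; first by rewrite e.
have [|[m r]] := tau_next_fin te; first by rewrite e.
exists t, m; split=> //; move: e; rewrite (tau_next te r) => -[] /eqP.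
by rewrite eqr_nat => /eqP.
Qed.

Definition tau_at n t : set T := [set w | tau n w = (t%:R)%:E].

(** The stopping time property: the event splits into an earlier value of the previous time and a
    first return, both readable from the history up to [t]. *)
Lemma determined_tau_at n t : determined t (tau_at n t).
Proof.
elim: n t => [|n IH] s w w' a; first by [].
move=> /tau_nextP[t [m [te r se]]]; rewrite se in a *; apply: tau_next.
  by apply: IH te; apply: agreeW a; exact: leq_addr.
exact: determined_return a r.
Qed.

Lemma tau_at_before n i t w : (i <= n)%N -> tau_at n t w ->
  exists2 s, (s <= t)%N & tau_at i s w.
Proof.
move=> ni; rewrite -(subnK ni); elim: (n - i)%N t => [|k IH] t; first by exists t.
move=> /tau_nextP[s [m [/IH[r rs ri] _ ->]]]; exists r => //.
by rewrite (leq_trans rs)// leq_addr.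
Qed.

Lemma tau_at_inj n t t' w : tau_at n t w -> tau_at n t' w -> t = t'.
Proof. by rewrite /tau_at /= => -> [] /eqP; rewrite eqr_nat => /eqP. Qed.

Lemma tau_at_origin n t w : tau_at n t w -> origin t w.
Proof.
move=> h; have [|[s hs os]] := tauP n w; first by rewrite h.
by rewrite (tau_at_inj h hs).
Qed.

(** * Integrals at the return times *)

Definition tau_nat n w : nat := Num.truncn (fine (tau n w)).

Definition stopped (f : nat -> nat -> int -> int -> R) n w : R :=
  state_fun (tau_nat n w) w f.

Definition tau_finite n : set T := \bigcup_t tau_at n t.

Definition gap n l : set T := \bigcup_t (tau_at n t `&` return_in t l.+1.*2).

(** The sigma-algebra of the stopping time tau_n, as far as it concerns finite values. *)
Definition stop_determined n (B : set T) := forall t, determined t (B `&` tau_at n t).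

Lemma tau_natE n t w : tau_at n t w -> tau_nat n w = t.
Proof. by rewrite /tau_at /tau_nat /= => ->; rewrite /= natrK. Qed.

Lemma Mrd_stopped n w : Mrd X n w = stopped ratio n w.
Proof. by []. Qed.

Lemma tau_at_measurable n t : measurable (tau_at n t).
Proof. exact: determined_measurable (@determined_tau_at n t). Qed.

Lemma tau_finite_measurable n : measurable (tau_finite n).
Proof. by apply: bigcup_measurable => t _; exact: tau_at_measurable. Qed.

Lemma tau_nat_measurable n s : measurable [set w | tau_nat n w = s].
Proof.
have H t : [set w | tau_nat n w = t.+1] = tau_at n t.+1.
  apply/seteqP; split=> w /=; last exact: tau_natE.
  have [e|[t' te _]] := tauP n w; first by rewrite /tau_nat e /= truncn0.
  by rewrite (tau_natE te) => <-.
case: s => [|s]; last by rewrite H; exact: tau_at_measurable.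
(* The value 0 is also the default for an infinite time, so this class is obtained as a
   complement. *)
rewrite (_ : [set _ | _] = ~` \bigcup_t [set w | tau_nat n w = t.+1]).
  apply: measurableC; apply: bigcup_measurable => t _; rewrite H.
  exact: tau_at_measurable.
apply/seteqP; split=> w /= h; first by case=> t _ /=; rewrite h.
by case e : (tau_nat n w) => [//|t]; case: h; exists t.
Qed.

Lemma stopped_measurable n f : measurable_fun setT (stopped f n).
Proof.
move=> _ B mB; rewrite setTI.
rewrite (_ : _ @^-1` _ = \bigcup_s ([set w | tau_nat n w = s] `&`
                                    [set w | B (state_fun s w f)])).
  apply: bigcup_measurable => s _; apply: measurableI.
    exact: tau_nat_measurable.
  have mf : measurable_fun setT (fun w => state_fun s w f).
    by apply: (@determined_measurable_fun s) => w w' /agree_state ->.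
  by have := mf measurableT B mB; rewrite setTI.
apply/seteqP; split=> w /=; first by exists (tau_nat n w).
by case=> s _ [/= <-].
Qed.

Lemma stopped_measurable_EFin n f (D : set T) :
  measurable_fun D (fun w => (stopped f n w)%:E).
Proof.
apply: (measurable_funS measurableT) => //; apply/measurable_EFinP.
exact: stopped_measurable.
Qed.

Lemma return_in_inj t m m' w : return_in t m w -> return_in t m' w -> m = m'.
Proof.
move=> [m0 o h] [m0' o' h']; case: (ltngtP m m') => // mm.
  by move: o; rewrite (negbTE (h' _ _))// m0.
by move: o'; rewrite (negbTE (h _ _))// m0'.
Qed.

Lemma gap_trivIset n : trivIset setT (gap n).
Proof.
move=> l l' _ _ [w [[t _ [a r]] [t' _ [a' r']]]].
rewrite (tau_at_inj a' a) in r'.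
by move: (return_in_inj r r') => /double_inj[].
Qed.

Lemma gap_measurable n l : measurable (gap n l).
Proof.
apply: bigcup_measurable => t _; apply: measurableI; first exact: tau_at_measurable.
exact: determined_measurable (@determined_return _ _).
Qed.

Lemma stop_determined_measurable n B : stop_determined n B ->
  measurable (B `&` tau_finite n).
Proof.
move=> dB; rewrite setI_bigcupr; apply: bigcup_measurable => t _.
exact: determined_measurable (dB t).
Qed.

Lemma tau_at_return n t m w : tau_at n t w -> return_in t m w -> tau_nat n.+1 w = (t + m)%N.
Proof. by move=> a r; apply: tau_natE; exact: tau_next. Qed.

Section Stopped.
Variable f : nat -> nat -> int -> int -> R.
Hypothesis f0 : forall u v a b, 0 <= f u v a b.
Hypothesis f1 : forall u v a b, f u v a b <= 1.
Hypothesis fr : forall l u v, (0 < u + v)%N ->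
  first_return f l.+1.*2 u v 0 0 = 2^-1 ^+ l.+1 * f u v 0 0.

Let stopped0 n w : (0 <= (stopped f n w)%:E)%E.
Proof. by rewrite lee_fin /stopped /state_fun. Qed.

(** Split by the value [t] of tau_n; each slice is determined at [t] and starts at the origin, so
    [integral_return_origin] applies. *)
Lemma integral_gap n l B : stop_determined n B ->
  (\int[P]_(w in B `&` gap n l) (stopped f n.+1 w)%:E =
   (2^-1 ^+ l.+1)%:E * \int[P]_(w in B `&` tau_finite n) (stopped f n w)%:E)%E.
Proof.
move=> dB; rewrite /gap /tau_finite !setI_bigcupr.
rewrite !ge0_integral_bigcup//; last first.
- by move=> s t _ _ [w [[_ [/tau_at_inj h _]] [_ [/h]]]].
- exact: stopped_measurable_EFin.
- move=> t; rewrite setIA; apply: measurableI; first exact: determined_measurable (dB t).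
  exact: determined_measurable (@determined_return _ _).
- by move=> s t _ _ [w [[_ /tau_at_inj h] [_ /h]]].
- exact: stopped_measurable_EFin.
- by move=> t; exact: determined_measurable (dB t).
rewrite -nneseriesZl; last by move=> t _; exact: integral_ge0.
apply: eq_eseriesr => t _; rewrite setIA.
have := @integral_return_origin f _ t l f0 (fr l) (dB t).
move=> /(_ ltac:(by move=> w [_ /tau_at_origin])) h.
rewrite (eq_integral (fun w => (state_fun (t + l.+1.*2) w f)%:E)) ?h; last first.
  by move=> w; rewrite inE => -[[_ a] r]; rewrite /stopped (tau_at_return a r).
by congr (_ * _)%E; apply: eq_integral => w; rewrite inE => -[_ /tau_natE a];
  rewrite /stopped a.
Qed.

(** The factors 2^-(l+1) sum to 1, so even gaps alone preserve the integral. With the constant 1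
    this gives recurrence, with [ratio] the martingale identity. *)
Lemma integral_gaps n B : stop_determined n B ->
  (\int[P]_(w in B `&` \bigcup_l gap n l) (stopped f n.+1 w)%:E =
   \int[P]_(w in B `&` tau_finite n) (stopped f n w)%:E)%E.
Proof.
move=> dB; rewrite setI_bigcupr ge0_integral_bigcup//; last first.
- by move=> l l' _ _ [w [[_ g] [_ g']]]; apply: (@gap_trivIset n) => //; exists w.
- exact: stopped_measurable_EFin.
- move=> l; rewrite /gap setI_bigcupr; apply: bigcup_measurable => t _; rewrite setIA.
  apply: measurableI; first exact: determined_measurable (dB t).
  exact: determined_measurable (@determined_return _ _).
under eq_eseriesr do rewrite integral_gap//.
set I := integral _ _ _; have I0 : (0 <= I)%E by exact: integral_ge0.
(* The bound on [f] makes [I] a real constant that can be taken out of the series. *)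
have Ifin : (I < +oo)%E.
  have mB := stop_determined_measurable dB.
  apply: (@le_lt_trans _ _ (\int[P]_(w in B `&` tau_finite n) (cst 1%E w))%E).
    apply: ge0_le_integral => //; first exact: stopped_measurable_EFin.
    by move=> w _; rewrite lee_fin /stopped /state_fun.
  by rewrite integral_cst// mul1e (le_lt_trans (probability_le1 P mB))// ltry.
rewrite -(fineK (_ : I \is a fin_num)) ?ge0_fin_numE//.
under eq_eseriesr do rewrite muleC.
by rewrite nneseriesZl ?half_series ?mule1// => l _; rewrite lee_fin exprn_ge0.
Qed.

End Stopped.

(** * The law of the gaps *)

Lemma stop_determinedT n : stop_determined n setT.
Proof. by move=> t; rewrite setTI; exact: determined_tau_at. Qed.

Lemma integral_one (D : set T) : measurable D ->
  (\int[P]_(w in D) (1%R : R)%:E = P D)%E.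
Proof. by move=> mD; rewrite integral_cst// mul1e. Qed.

Definition gaps n : set T := \bigcup_l gap n l.

Lemma gaps_measurable n : measurable (gaps n).
Proof. by apply: bigcup_measurable => l _; exact: gap_measurable. Qed.

Lemma first_return_one l u v : (0 < u + v)%N ->
  first_return (fun _ _ _ _ => 1 : R) l.+1.*2 u v 0 0 = 2^-1 ^+ l.+1 * 1.
Proof. by move=> uv; rewrite first_return_origin ?mulr1. Qed.

Lemma probability_gaps n : P (gaps n) = P (tau_finite n).
Proof.
have := @integral_gaps (fun _ _ _ _ => 1) (fun _ _ _ _ => ler01)
  (fun _ _ _ _ => lexx 1) first_return_one n setT (@stop_determinedT n).
rewrite /stopped /state_fun !setTI !integral_one//.
- exact: tau_finite_measurable.
- exact: gaps_measurable.
Qed.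

Lemma gaps_finite n : gaps n `<=` tau_finite n.+1.
Proof. by move=> w [l _ [t _ [a r]]]; exists (t + l.+1.*2)%N => //; exact: tau_next. Qed.

(** The even gaps carry the full mass of the finite values of tau_n and force tau_(n+1) to be
    finite. Recurrence thus follows by induction, with odd gaps excluded by mass. *)
Lemma probability_tau_finite n : P (tau_finite n) = 1%E.
Proof.
elim: n => [|n IH].
  rewrite (_ : tau_finite 0 = setT) ?probability_setT//.
  by apply/seteqP; split=> // w _; exists 0%N.
apply/eqP; rewrite eq_le probability_le1/=; last exact: tau_finite_measurable.
rewrite -IH -probability_gaps; apply: le_measure (@gaps_finite n); rewrite inE.
  exact: gaps_measurable.
exact: tau_finite_measurable.
Qed.

Lemma probability_gap n l : P (gap n l) = (2^-1 ^+ l.+1)%:E.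
Proof.
have := @integral_gap (fun _ _ _ _ => 1) (fun _ _ _ _ => ler01)
  first_return_one n l setT (@stop_determinedT n).
rewrite /stopped /state_fun !setTI !integral_one//.
- by rewrite [P (tau_finite n)]probability_tau_finite mule1.
- exact: tau_finite_measurable.
- exact: gap_measurable.
Qed.

Lemma gap_increment n l :
  [set w | (tau n.+1 w - tau n w)%E = ((2 * l.+1)%:R : R)%:E] = gap n l.
Proof.
apply/seteqP; split=> w; rewrite /mkset.
  (* If tau_n = +oo, the difference is -oo by convention, so it cannot equal a natural number. *)
  have [e|[t te ot]] := tauP n w; first by rewrite e addeNy.
  have [e|[m r]] := tau_next_fin te; first by rewrite e te.
  rewrite (tau_next te r) te -EFinB natrD addrC addKr => -[] /eqP.
  rewrite eqr_nat mul2n => /eqP ml; exists t => //; split => //.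
  by rewrite -ml.
move=> [t _ [a r]]; rewrite (tau_next a r) a -EFinB natrD addrC addKr.
by rewrite mul2n.
Qed.

Lemma tau_increment_law n l : (1 <= l)%N ->
  P [set w | (tau n.+1 w - tau n w)%E = ((2 * l)%:R : R)%:E] = (2^-1 ^+ l)%:E.
Proof. by case: l => // l _; rewrite gap_increment; exact: probability_gap. Qed.

Lemma tau_measurable n : measurable_fun setT (tau n).
Proof.
move=> _ B mB; rewrite setTI.
have mc (Q : Prop) : measurable [set _ : T | Q].
  have [q|q] := pselect Q.
    by rewrite (_ : [set _ | _] = setT)//; apply/seteqP; split.
  by rewrite (_ : [set _ | _] = set0)//; apply/seteqP; split.
rewrite (_ : _ @^-1` _ = (\bigcup_t (tau_at n t `&` [set _ | B (t%:R)%:E])) `|`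
   (~` tau_finite n `&` [set _ | B +oo%E])).
  apply: measurableU.
    apply: bigcup_measurable => t _; apply: measurableI => //.
    exact: tau_at_measurable.
  apply: measurableI => //; apply: measurableC; exact: tau_finite_measurable.
apply/seteqP; split=> w /=.
  have [e|[t te ot]] := tauP n w => Bt; [right|left].
    by rewrite -e; split=> // -[t _]; rewrite /tau_at /= e.
  by exists t => //; rewrite -te.
case=> [[t _ [/= -> //]]|[nf Boo]].
have [->//|[t te _]] := tauP n w.
by case: nf; exists t.
Qed.

Lemma conull_integral (E D : set T) (f : T -> \bar R) :
  measurable E -> measurable D -> P E = 1%E -> measurable_fun D f ->
  (forall w, D w -> 0 <= f w)%E ->
  (\int[P]_(w in D) f w = \int[P]_(w in D `&` E) f w)%E.
Proof.
move=> mE mD E1 mf f0.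
have PE : P (~` E) = 0%E by rewrite probability_setC// E1 subee.
by rewrite (ge0_negligible_integral _ _ _ _ PE) ?setDE ?setCK//; exact: measurableC.
Qed.

Lemma tau_increment_mean n : (\int[P]_w (tau n.+1 w - tau n w) = (4 : R)%:E)%E.
Proof.
have mg := gaps_measurable n.
have mt : measurable_fun setT (fun w => tau n.+1 w - tau n w)%E.
  by apply: emeasurable_funB; exact: tau_measurable.
have h0 w : gaps n w -> (0 <= tau n.+1 w - tau n w)%E.
  move=> [l _]; rewrite -gap_increment /mkset => ->; by rewrite lee_fin.
have g1 : P (gaps n) = 1%E by rewrite probability_gaps probability_tau_finite.
(* Off [gaps n] the increment may be infinite of either sign. Restricting it to this set of full
   measure makes it nonnegative before the sum over gaps. *)
rewrite (@ae_eq_integral _ _ _ P setT ((fun w => tau n.+1 w - tau n w)%E \_ (gaps n)))//.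
- rewrite -integral_mkcond /gaps ge0_integral_bigcup//; last 3 first.
  + by move=> l; exact: gap_measurable.
  + exact: measurable_funS mt.
  + exact: gap_trivIset.
  rewrite -mean_half_series; apply: eq_eseriesr => l _.
  rewrite (eq_integral (cst ((l.+1.*2)%:R : R)%:E)); last first.
    by move=> w; rewrite inE -gap_increment /mkset => ->; rewrite mul2n.
  by rewrite integral_cst ?EFinM; [congr (_ * _)%E; exact: probability_gap|exact: gap_measurable].
- apply/(measurable_restrictT _ mg); exact: measurable_funS mt.
- exists (~` gaps n); split; first exact: measurableC.
    by have := @probability_setC _ _ _ P _ mg; rewrite g1 subee.
  move=> w /=; apply: contra_not => /= gw _; by rewrite patchE mem_set.
Qed.

(** * The martingale property *)

Local Notation Mrd := (@Defs.Mrd T R X).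

Lemma ratio_ge0 u v (a b : int) : (0 : R) <= ratio u v a b.
Proof. by rewrite /ratio divr_ge0. Qed.

Lemma ratio_le1 u v (a b : int) : ratio u v a b <= 1 :> R.
Proof.
rewrite /ratio; case: (posnP (u + v)%N) => [->|uv]; first by rewrite mulr0n invr0 mulr0 ler01.
by rewrite ler_pdivrMr ?ltr0n// mul1r ler_nat leq_addr.
Qed.

Lemma Mrd_ge0 n w : 0 <= Mrd n w. Proof. exact: (ratio_ge0 _ _ 0 0). Qed.

Lemma Mrd_le1 n w : Mrd n w <= 1. Proof. exact: (ratio_le1 _ _ 0 0). Qed.

Lemma Mrd_measurable n : measurable_fun setT (Mrd n).
Proof. exact: (@stopped_measurable n ratio). Qed.

Lemma Mrd_integrable n : P.-integrable setT (EFin \o Mrd n).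
Proof.
apply: measurable_bounded_integrable => //.
- by apply: (le_lt_trans (probability_le1 P measurableT)); rewrite ltry.
- exact: Mrd_measurable.
- exists 1; split=> // r r1 w _ /=.
  by rewrite ger0_norm ?Mrd_ge0// (le_trans (Mrd_le1 _ _))// ltW.
Qed.

Lemma natural_filtration_measurable n : natural_filtration Mrd n `<=` measurable.
Proof.
apply: smallest_sub; first exact: sigma_algebra_measurable.
by move=> _ [i _ [B mB <-]]; exact: Mrd_measurable.
Qed.

Lemma natural_filtration_filtration : filtration (natural_filtration Mrd).
Proof.
split=> [n|n|n m nm]; first exact: smallest_sigma_algebra.
  exact: natural_filtration_measurable.
apply: sub_sigma_algebra2 => A [i /= ni Ai]; exists i => //=.
exact: leq_trans nm.
Qed.

Lemma Mrd_adapted n : sigma_measurable (natural_filtration Mrd n) (Mrd n).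
Proof.
move=> B mB; apply: sub_sigma_algebra; exists n => //=.
by exists B; rewrite ?setTI.
Qed.

(** For i <= n the variable [Mrd i] is read from the history up to tau_i <= tau_n, so the generators
    lie in the sigma-algebra of tau_n. *)
Lemma natural_filtration_determined n A :
  natural_filtration Mrd n A -> stop_determined n A.
Proof.
(* Leaving the stopping event out of the conclusion gives a class closed under complements and
   countable unions. *)
suff H : natural_filtration Mrd n `<=`
    [set B | forall t w w', tau_at n t w -> agree t w w' -> B w -> B w'].
  move=> /H hA t w w' e [Aw a]; split; first exact: hA a e Aw.
  exact: determined_tau_at e a.
apply: smallest_sub.
  split=> [//|B hB t w w' a e [_ nB]|F hF t w w' a e [k _ Fk]].
    split=> // Bw'; apply: nB; apply: hB Bw'; last exact: agree_sym e.
    exact: determined_tau_at e a.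
  by exists k => //; exact: hF a e Fk.
move=> _ [i ni [B _ <-]] t w w' a e [_ Bw]; split=> //=.
have [s st si] := tau_at_before ni a.
have es := agreeW st e; have si' := determined_tau_at es si.
move: Bw; rewrite /= !Mrd_stopped /stopped (tau_natE si) (tau_natE si').
by rewrite (agree_state es).
Qed.

Lemma Mrd_cond_expectation n :
  is_cond_expectation P (natural_filtration Mrd n) (Mrd n.+1) (Mrd n).
Proof.
split; [exact: Mrd_integrable|exact: Mrd_integrable|exact: Mrd_adapted|].
move=> A FA; have mA := natural_filtration_measurable FA.
have dA := natural_filtration_determined FA.
(* Both integrals are cut down to sets of full measure, [tau_finite n] for [n] and [gaps n] for n +
   1, on which [integral_gaps] equates them. *)
rewrite (conull_integral (tau_finite_measurable n))//; last 3 first.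
- exact: probability_tau_finite.
- exact: (@stopped_measurable_EFin n ratio).
- by move=> w _; rewrite lee_fin Mrd_ge0.
rewrite [RHS](conull_integral (gaps_measurable n))//; last 3 first.
- by rewrite [LHS]probability_gaps; exact: probability_tau_finite.
- exact: (@stopped_measurable_EFin n.+1 ratio).
- by move=> w _; rewrite lee_fin Mrd_ge0.
by rewrite -(integral_gaps ratio_ge0 ratio_le1 (@first_return_ratio R) dA).
Qed.

Lemma Mrd_martingale : martingale P (natural_filtration Mrd) Mrd.
Proof.
split; [exact: natural_filtration_filtration|exact: Mrd_integrable|
  exact: Mrd_adapted|exact: Mrd_cond_expectation].
Qed.

(** * Almost sure convergence *)

Lemma step_total_weight m u v (a b : int) : (0 < u + v)%N ->
  a \in [:: -1; 0; 1] -> b \in [:: -1; 0; 1] ->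
  step (fun u v _ _ => (u + v != m.+1)%N%:R : R) u v a b = (u + v != m)%N%:R.
Proof.
move=> uv ha hb.
suff H c : c \in [:: -1; 0; 1] ->
    jump (fun u v _ => (u + v != m.+1)%N%:R : R) u v c = (u + v != m)%N%:R.
  by rewrite /step !H//; field.
rewrite !inE /jump => /or3P[] /eqP->; rewrite /= ?addn0 ?addn1 ?addSn ?addnS ?eqSS//.
by rewrite -mulrDl left_shareE// subrK mul1r.
Qed.

(** Forbidden moves, such as a chosen walker staying at 0, have probability zero but are not
    excluded pointwise. Hence the total weight is known only almost surely, by propagating the
    indicator of a wrong total. *)
Lemma total_weight_null n :
  P [set w | (left_weight n w + right_weight n w != n + 2)%N] = 0%E.
Proof.
pose f m u v (a b : int) : R := (u + v != m)%N%:R.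
have f0 m u v a b : 0 <= f m u v a b by [].
have mS m : measurable [set w | (left_weight m w + right_weight m w != m + 2)%N].
  apply: (@determined_measurable m) => w w' e.
  by rewrite /= /left_weight /right_weight !(agree_weight _ e).
have fP m : (\int[P]_w (state_fun m w (f (m + 2)%N))%:E =
    P [set w | (left_weight m w + right_weight m w != m + 2)%N])%E.
  rewrite (integral_split measurableT (mS m) (state_measurable _ _)); last first.
    by move=> w; rewrite lee_fin /state_fun.
  rewrite [X in (_ + X)%E]integral0_eq; last first.
    by move=> w [_ /= /negP/negPn e]; rewrite /state_fun /f e.
  rewrite adde0 setTI (eq_integral (cst 1%E)) ?integral_cst ?mul1e//.
  by move=> w; rewrite inE /state_fun /f /= => ->.
rewrite -fP; elim: n => [|n IH].
  apply: integral0_eq => w _; rewrite /state_fun /f /left_weight /right_weight.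
  by rewrite /weight /crossings !big1// => k _; rewrite big_geq.
rewrite (@integral_step n (fun=> f (n.+1 + 2)%N))//.
rewrite -IH; apply: eq_integral => w _; rewrite /state_fun.
rewrite [f (n.+1 + 2)%N](_ : _ = fun u v _ _ => (u + v != (n + 2).+1)%N%:R)//.
by rewrite step_total_weight ?(walker_vertex hX).
Qed.

Lemma total_weight_ae :
  {ae P, forall w, forall n, (left_weight n w + right_weight n w = n + 2)%N}.
Proof.
apply: ae_foralln => n; exists [set w | (left_weight n w + right_weight n w != n + 2)%N].
split; last by move=> w /= /eqP.
  apply: (@determined_measurable n) => w w' e.
  by rewrite /= /left_weight /right_weight !(agree_weight _ e).
exact: total_weight_null.
Qed.

Lemma completed_ratio_ge0 u v (a b : int) : (0 : R) <= completed_ratio u v a b.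
Proof. by rewrite /completed_ratio divr_ge0. Qed.

Lemma completed_ratio_le1 u v (a b : int) : completed_ratio u v a b <= 1 :> R.
Proof.
rewrite /completed_ratio; set s := (_ + _ + _ + _)%N.
case: (posnP s) => [->|s0]; first by rewrite mulr0n invr0 mulr0 ler01.
by rewrite ler_pdivrMr ?ltr0n// mul1r ler_nat /s; lia.
Qed.

Definition completed n w : R := state_fun n w completed_ratio.

(** With the value at time [n] frozen as the centre, each of the [j] steps adds at most 12 / (n +
    2)^2. *)
Lemma completed_variance n j :
  (\int[P]_w ((completed (n + j) w - completed n w) ^+ 2)%:E <=
   (12 * j%:R / (n + 2)%:R ^+ 2)%:E)%E.
Proof.
elim: j => [|j IH].
  by rewrite addn0 integral0_eq ?mulr0 ?mul0r// => w _; rewrite subrr expr0n.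
pose F w u v a b : R := (completed_ratio u v a b - completed n w) ^+ 2.
have F0 w u v a b : 0 <= F w u v a b by exact: sqr_ge0.
have dF w w' : agree (n + j) w w' -> F w = F w'.
  move=> e; rewrite /F /completed.
  by rewrite (agree_state (agreeW (leq_addr j n) e)).
rewrite addnS [leLHS](_ : _ = \int[P]_w (state_fun (n + j).+1 w (F w))%:E)%E//.
rewrite (integral_step F0 dF)//.
have mF : measurable_fun setT (fun w => (state_fun (n + j) w (F w))%:E).
  by apply: (@determined_measurable_fun (n + j)) => w w' e; rewrite (agree_state e) (dF _ _ e).
apply: (@le_trans _ _ (\int[P]_w ((state_fun (n + j) w (F w))%:E +
    cst ((12 / (n + 2)%:R ^+ 2)%:E) w))%E).
  (* The comparison is almost sure because it uses the total weight. *)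
  apply: ae_ge0_le_integral => //.
  - by move=> w _; rewrite lee_fin /state_fun step_ge0.
  - exact: determined_step.
  - move=> w _; rewrite -EFinD lee_fin; apply: addr_ge0; first exact: F0.
    by rewrite divr_ge0// exprn_ge0.
  - exact: emeasurable_funD.
  apply: filterS total_weight_ae => w tw _.
  rewrite -EFinD lee_fin /state_fun.
  apply: le_trans (@step_completed_ratio R _ _ _ _ _ _ _ _ _) _.
  - by rewrite tw addn2.
  - exact: walker_vertex hX _ _ _.
  - exact: walker_vertex hX _ _ _.
  - by rewrite /completed /state_fun completed_ratio_ge0 completed_ratio_le1.
  rewrite tw lerD2l ler_wpM2l// lef_pV2 ?posrE ?exprn_gt0 ?ltr0n ?addn2//.
  by rewrite lerXn2r ?nnegrE// ler_nat; lia.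
rewrite ge0_integralD//=; last first.
  by move=> w _; rewrite lee_fin; exact: F0.
rewrite integral_cst//= [X in (_ + _ * X <= _)%E](_ : _ = 1%E); last exact: probability_setT.
rewrite mule1; apply: le_trans (leeD2r _ IH) _.
by rewrite -EFinD lee_fin -[j.+1%:R]natr1 mulrDr mulr1 mulrDl.
Qed.

(** From k^3 to (k + 1)^3 there are O(k^2) steps, so the mean squared increment is O(k^-4). The
    weight (k + 1)^2 leaves a summable O(k^-2), so the weighted series is integrable and finite
    almost everywhere. *)
Lemma completed_cubes_ae : {ae P, forall w, cvgn (fun k => completed (k ^ 3)%N w)}.
Proof.
pose v k w : \bar R :=
  ((k.+1%:R ^+ 2) * (completed (k.+1 ^ 3)%N w - completed (k ^ 3)%N w) ^+ 2)%:E.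
have v0 k w : (0 <= v k w)%E by rewrite lee_fin mulr_ge0// sqr_ge0.
have mD n j : measurable_fun setT (fun w => ((completed (n + j) w - completed n w) ^+ 2)%:E).
  apply: (@determined_measurable_fun (n + j)) => w w' e.
  by rewrite /completed (agree_state e) (agree_state (agreeW (leq_addr j n) e)).
have cubeS k : (k.+1 ^ 3 = k ^ 3 + (3 * k ^ 2 + 3 * k + 1))%N by nia.
have mv k : measurable_fun setT (v k).
  rewrite [v k](_ : _ = (fun w => (k.+1%:R ^+ 2)%:E *
      ((completed (k.+1 ^ 3) w - completed (k ^ 3) w) ^+ 2)%:E)%E).
    by apply: measurable_funeM; rewrite cubeS; exact: mD.
  by apply/funext => w; rewrite /v EFinM.
have [C C0 Iv] : exists2 C : R, 0 <= C &
    forall k, (\int[P]_w v k w <= (C * (k.+1%:R ^+ 2)^-1)%:E)%E.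
  (* 576 = 36 * 16: at most 3 (k + 1)^2 steps cost 12 each, and squaring (k + 1)^3 <= 4 (k^3 + 2)
     gives the 16. *)
  exists 576; [exact: ler0n|move=> k]; rewrite /v; under eq_integral do rewrite EFinM.
  rewrite ge0_integralZl//; last 2 first.
  - by rewrite cubeS; exact: mD.
  - by move=> w _; rewrite lee_fin sqr_ge0.
  rewrite cubeS; apply: le_trans (lee_wpmul2l _ (completed_variance _ _)) _.
    by rewrite lee_fin exprn_ge0.
  rewrite -EFinM lee_fin ler_pdivlMr ?exprn_gt0 ?ltr0n//.
  rewrite mulrAC [leLHS]mulrA ler_pdivrMr ?exprn_gt0 ?ltr0n ?addn2//.
  rewrite -!natrX -!natrM ler_nat.
  have h1 : (3 * k ^ 2 + 3 * k + 1 <= 3 * k.+1 ^ 2)%N by nia.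
  have h2 : (k.+1 ^ 3 <= 4 * (k ^ 3).+2)%N by nia.
  have h3 : (k.+1 ^ 3 * k.+1 ^ 3 <= 4 * (k ^ 3).+2 * (4 * (k ^ 3).+2))%N by exact: leq_mul.
  apply: (@leq_trans (k.+1 ^ 2 * k.+1 ^ 2 * (12 * (3 * k.+1 ^ 2)))).
    by rewrite !leq_mul2l h1 !orbT.
  have -> : (k.+1 ^ 2 * k.+1 ^ 2 * (12 * (3 * k.+1 ^ 2)) = 36 * (k.+1 ^ 3 * k.+1 ^ 3))%N by ring.
  have -> : (576 * (k ^ 3).+2 ^ 2 = 36 * (4 * (k ^ 3).+2 * (4 * (k ^ 3).+2)))%N by ring.
  by rewrite leq_mul2l h3 orbT.
have mW : measurable_fun setT (fun w => \sum_(k <oo) v k w)%E.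
  by apply: ge0_emeasurable_sum.
have W0 w : (0 <= \sum_(k <oo) v k w)%E by exact: nneseries_ge0.
have W : P.-integrable setT (fun w => \sum_(k <oo) v k w)%E.
  apply/integrableP; split => //.
  under eq_integral do rewrite gee0_abs//.
  rewrite integral_nneseries//.
  apply: (@le_lt_trans _ _ (\sum_(k <oo) (C * (k.+1%:R ^+ 2)^-1)%:E)%E).
    by apply: lee_nneseries => [k _ _|k _]; [exact: integral_ge0|exact: Iv].
  apply: (@le_lt_trans _ _ (C * 2)%:E); last exact: ltry.
  apply: lime_le; first apply: is_cvg_nneseries => k _ _.
    by rewrite lee_fin mulr_ge0// invr_ge0 exprn_ge0.
  apply: nearW => n; rewrite sumEFin lee_fin -mulr_sumr ler_wpM2l//.
  exact: series_inv_square_bounded.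
apply: filterS (integrable_ae measurableT W) => w /(_ I) fw.
apply: weighted_increments_cvg.
by rewrite -ge0_fin_numE//; exact: W0.
Qed.

Lemma weight_homo w l n m : (n <= m)%N ->
  (weight (fun k i => X k i w) n l <= weight (fun k i => X k i w) m l)%N.
Proof.
move=> nm; rewrite leq_add2l; apply: leq_sum => k _.
by rewrite (@big_cat_nat _ _ _ n.+1 1 m.+1)//= leq_addr.
Qed.

Lemma Nproc_state n w : Nproc X n w = state_fun n w ratio.
Proof. by []. Qed.

Lemma Nproc_increment w : (forall n, (left_weight n w + right_weight n w = n + 2)%N) ->
  forall n m, (n <= m)%N ->
  `|Nproc X m w - Nproc X n w| <= (m - n)%:R / (n + 2)%:R :> R.
Proof.
move=> hw n m nm.
have hl : (left_weight n w <= left_weight m w)%N by exact: weight_homo.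
have hr : (right_weight n w <= right_weight m w)%N by exact: weight_homo.
rewrite !Nproc_state /state_fun /ratio !hw; have := hw n; have := hw m.
move: (left_weight n w) (right_weight n w) (left_weight m w) (right_weight m w) hl hr.
move=> u v u' v' uu vv e' e.
have m0 : (0 : R) < (m + 2)%:R by rewrite ltr0n addn2.
have n0 : (0 : R) < (n + 2)%:R by rewrite ltr0n addn2.
have -> : u'%:R / (m + 2)%:R - u%:R / (n + 2)%:R =
    (u'%:R * (n + 2)%:R - u%:R * (m + 2)%:R) / (m + 2)%:R / (n + 2)%:R :> R.
  by move: m0 n0; move: ((m + 2)%:R) ((n + 2)%:R) => a b a0 b0; field; rewrite !gt_eqF.
rewrite normrM normfV (ger0_norm (ltW n0)) ler_wpM2r ?invr_ge0 ?(ltW n0)//.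
rewrite normrM normfV (ger0_norm (ltW m0)) ler_pdivrMr// -!natrM ler_norml.
apply/andP; split.
  by rewrite lerBrDr addrC lerBlDr -natrD ler_nat; nia.
by rewrite lerBlDr -natrD ler_nat; nia.
Qed.

(** The completion adds at most two owed crossings to a total of n + 2. *)
Lemma Nproc_completed w : (forall n, (left_weight n w + right_weight n w = n + 2)%N) ->
  forall n, `|Nproc X n w - completed n w| <= 2 / (n + 2)%:R :> R.
Proof.
move=> hw n; rewrite Nproc_state /completed /state_fun /ratio /completed_ratio.
have := hw n; set o := ((_ == -1)%R + _)%N; set r := ((_ == 1)%R + _)%N.
have o2 : (o <= 2)%N by rewrite /o; do 2 case: (_ == -1).
have or2 : (o + r <= 2)%N.
  have := walker_vertex hX k0 n w; have := walker_vertex hX k1 n w.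
  by rewrite /o /r !inE => /or3P[] /eqP-> /or3P[] /eqP->.
move: o r o2 or2 (left_weight n w) (right_weight n w) => o r o2 or2 u v e.
rewrite e; have n0 : (0 : R) < (n + 2)%:R by rewrite ltr0n addn2.
have m0 : (0 : R) < (n + 2 + o + r)%:R by rewrite ltr0n; lia.
have -> : u%:R / (n + 2)%:R - (u + o)%:R / (n + 2 + o + r)%:R =
    (u%:R * (n + 2 + o + r)%:R - (u + o)%:R * (n + 2)%:R) / (n + 2 + o + r)%:R / (n + 2)%:R :> R.
  by move: m0 n0; move: ((n + 2 + o + r)%:R) ((n + 2)%:R) => a b a0 b0; field; rewrite !gt_eqF.
rewrite normrM normfV (ger0_norm (ltW n0)) ler_wpM2r ?invr_ge0 ?(ltW n0)//.
rewrite normrM normfV (ger0_norm (ltW m0)) ler_pdivrMr// -!natrM ler_norml.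
apply/andP; split.
  by rewrite lerBrDr addrC lerBlDr -natrD ler_nat; nia.
by rewrite lerBlDr -natrD ler_nat; nia.
Qed.

Lemma Nproc_cvg_ae : {ae P, forall w, cvgn (fun n => Nproc X n w : R)}.
Proof.
apply: filterS2 completed_cubes_ae total_weight_ae => w cw hw.
apply/cvg_ex; exists (limn (fun k => completed (k ^ 3)%N w)).
apply: cubes_cvg; first exact: Nproc_increment.
rewrite (_ : (fun k => _) = (fun k => (Nproc X (k ^ 3)%N w - completed (k ^ 3)%N w) +
    completed (k ^ 3)%N w)); last by apply/funext => k; rewrite subrK.
rewrite -[X in _ --> X]add0r; apply: cvgD; last exact: cw.
(* The gap to the completed ratio at k^3 is at most 2 / (k^3 + 2) <= 2 / (k + 1). *)
apply/norm_cvg0P; apply: (@squeeze_cvgr _ _ _ _ (fun=> 0) (fun k => 2 * harmonic k)).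
- apply: nearW => k; rewrite normr_ge0/=; apply: le_trans (Nproc_completed hw _) _.
  rewrite ler_wpM2l// lef_pV2 ?posrE ?ltr0n ?addn2// ler_nat.
  by case: k => // k; nia.
- exact: cvg_cst.
- by rewrite -[X in _ --> X](mulr0 2); apply: cvgM; [exact: cvg_cst|exact: cvg_harmonic].
Qed.

Lemma tau_finite_ae : {ae P, forall w, forall n, tau_finite n w}.
Proof.
apply: ae_foralln => n; exists (~` tau_finite n); split => //.
  by apply: measurableC; exact: tau_finite_measurable.
have := @probability_setC _ _ _ P _ (@tau_finite_measurable n).
by rewrite [X in (_ - X)%E](probability_tau_finite n) subee.
Qed.

(** Every gap has length at least 1. *)
Lemma tau_at_ge n t w : tau_at n t w -> (n <= t)%N.
Proof.
elim: n t => // n IH t /tau_nextP[s [m [/IH ns [m0 _ _] ->]]]; lia.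
Qed.

(** Almost surely all tau_n are finite and tend to infinity, so [Mrd] samples the convergent [Nproc]
    along them and has the same limit. *)
Lemma Mrd_cvg_ae : {ae P, forall w, cvgn (Mrd ^~ w) /\
  (fun n => Nproc X n w : R) @ \oo --> (Mrd_lim X w : R)}.
Proof.
apply: filterS2 Nproc_cvg_ae tau_finite_ae => w /cvg_ex[/= l Nl] fw.
have Ml : Mrd ^~ w @ \oo --> l.
  apply: (@cvg_comp _ _ _ (tau_nat ^~ w) (fun n => Nproc X n w) _ \oo _ _ Nl).
  apply/cvgnyPge => A; exists A => // n /= An; have [t _ a] := fw n.
  by rewrite (tau_natE a) (leq_trans An)//; exact: tau_at_ge a.
by split; [apply/cvg_ex; exists l|rewrite /Mrd_lim (cvg_lim _ Ml)].
Qed.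

End Process.

Theorem theorem8 (R : realType) (d : measure_display) (T : measurableType d)
    (P : probability T R)
    (X : 'I_2 -> nat -> T -> int) (sel : nat -> T -> 'I_2)
    (hX : two_walkers P X sel) :
  [/\ [/\ martingale P (natural_filtration (Mrd X : nat -> T -> R)) (Mrd X),
          exists C : R, forall n w, `|Mrd X n w| <= C &
          {ae P, forall w, cvgn (fun n => Mrd X n w : R)}],
      forall n : nat,
        (forall l : nat, (1 <= l)%N ->
           P [set w | (tau X n.+1 w - tau X n w)%E = ((2 * l)%:R : R)%:E]
             = (2^-1 ^+ l)%:E) /\
        (\int[P]_w (tau X n.+1 w - tau X n w) = (4 : R)%:E)%E &
      {ae P, forall w, (fun n => Nproc X n w : R) @ \oo --> (Mrd_lim X w : R)}].
Proof.
split.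
- split; first exact: Mrd_martingale hX.
    by exists 1 => n w; rewrite ger0_norm ?Mrd_ge0 ?Mrd_le1.
  by apply: filterS (Mrd_cvg_ae hX) => w [].
- by move=> n; split=> [l l1|]; [exact: (tau_increment_law hX)|exact: (tau_increment_mean hX)].
- by apply: filterS (Mrd_cvg_ae hX) => w [].
Qed.
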